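(* Let $K$ be an algebraically closed field of characteristic $p>0$, let $s\ge 1$ be an integer, and let $n=sp+1$. Then the $a$-number of the Fermat curve $\mathcal{F}_{sp+1}$ over $K$ is $$a(\mathcal{F}_{sp+1})=\tfrac14\, s(s+1)p(p-1).$$
   Context: For a positive integer $n$ with $p\nmid n$, the Fermat curve $\mathcal{F}_n$ is the nonsingular projective plane curve over $K$ with affine equation $X^n+Y^n+1=0$. For a (projective, irreducible, nonsingular) curve $\mathcal{X}$ over $K$ with separating variable $x$ (i.e. $x\in K(\mathcal{X})\setminus K(\mathcal{X})^p$), every $f\in K(\mathcal{X})$ is uniquely $f=u_0^p+u_1^px+\dots+u_{p-1}^px^{p-1}$ with $u_i\in K(\mathcal{X})$; the Cartier operator is the $1/p$-linear map $\mathcal{C}(f\,dx)=u_{p-1}\,dx$ on differentials (it does not depend on $x$). It maps the $g$-dimensional $K$-space $H^0(\mathcal{X},\Omega^1)$ of holomorphic differentials into itself, where $g$ is the genus. The $a$-number $a(\mathcal{X})$ is the $K$-dimension of the kernel of $\mathcal{C}$ on $H^0(\mathcal{X},\Omega^1)$, equivalently the dimension of the space of exact holomorphic differentials (those of the form $df$, $f\in K(\mathcal{X})$). *)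

(* Defs.v *)
From HB Require Import structures.
From mathcomp Require Import all_boot all_algebra all_field.
From mathcomp Require Import boolp functions.
From mathcomp Require Import mpoly.

Set Implicit Arguments.
Unset Strict Implicit.
Unset Printing Implicit Defensive.

Import GRing.Theory Pdiv.Ring Pdiv.RingMonic.
Local Open Scope ring_scope.

(** * Differentials of a field extension [iota : K -> L] *)

Record derivation (K L : fieldType) (iota : {rmorphism K -> L}) := Derivation {
  der_fun :> L -> L;
  derivation_add : forall f g, der_fun (f + g) = der_fun f + der_fun g;
  derivation_mul : forall f g, der_fun (f * g) = f * der_fun g + g * der_fun f;
  derivation_const : forall c, der_fun (iota c) = 0
}.

(** [Der_K(L)] is the [L]-dual of the module of Kaehler differentials
    [Omega_{L/K}].  A vector space embeds in its bidual, so [Omega_{L/K}] is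
    identified with the [L]-span of the evaluations [df : D |-> D f] inside the
    [L]-vector space of all functions [Der_K(L) -> L]. *)
Definition form (K L : fieldType) (iota : {rmorphism K -> L}) : lmodType L :=
  derivation iota -> L^o.

Definition diff (K L : fieldType) (iota : {rmorphism K -> L}) (f : L) :
  form iota := fun D => D f.
Arguments diff {K L} iota f.

(** The differentials [sum_i f_i dg_i] with all [f_i] and [g_i] in [S]. *)
Definition differential_over (K L : fieldType) (iota : {rmorphism K -> L})
    (S : L -> Prop) (w : form iota) : Prop :=
  exists (m : nat) (f g : 'I_m -> L),
    (forall i, S (f i) /\ S (g i)) /\ w = \sum_(i < m) f i *: diff iota (g i).

Definition separating (L : fieldType) (p : nat) (x : L) : Prop :=
  ~ exists z : L, x = z ^+ p.

(** Graph of the Cartier operator: [w' = C(w)].  The operator does not depend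
    on [x], so any separating [x] may be used to compute it. *)
Definition cartier (K L : fieldType) (iota : {rmorphism K -> L}) (p : nat)
    (w w' : form iota) : Prop :=
  exists (x : L) (u : nat -> L),
    [/\ separating p x,
        w = (\sum_(i < p) u i ^+ p * x ^+ i) *: diff iota x &
        w' = u p.-1 *: diff iota x].

(** [V] is a [K]-subspace of dimension [d], with basis [b]. *)
Definition has_dim (K L : fieldType) (iota : {rmorphism K -> L})
    (V : form iota -> Prop) (d : nat) : Prop :=
  exists b : 'I_d -> form iota,
    (forall w, V w <->
       exists c : 'I_d -> K, w = \sum_(i < d) iota (c i) *: b i) /\
    (forall c : 'I_d -> K,
       \sum_(i < d) iota (c i) *: b i = 0 -> forall i, c i = 0).

(** * Fermat curves *)

(** A Fermat curve is given by its function field [K(x, y)], of equation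
    [x^n + y^n + 1 = 0] with [x] transcendental over [K].  Since
    [X^n + Y^n + 1] is irreducible for [n] prime to the characteristic, this
    determines the field up to isomorphism; see [fermat_curve_inhabited] for
    its existence. *)
Record fermat_curve (K : fieldType) (n : nat) := FermatCurve {
  function_field : fieldType;
  const : {rmorphism K -> function_field};
  coord_x : function_field;
  coord_y : function_field;
  fermat_eq : coord_x ^+ n + coord_y ^+ n + 1 = 0;
  coord_x_transcendental :
    forall q : {poly K}, (map_poly const q).[coord_x] = 0 -> q = 0;
  function_field_gen : forall f : function_field,
    exists G H : {mpoly K[2]},
      f = mmap const (tnth [tuple coord_x; coord_y]) G
          / mmap const (tnth [tuple coord_x; coord_y]) H
}.

Definition fermat_form (K : fieldType) (n : nat) : {mpoly K[3]} :=
  \sum_(i < 3) 'X_i ^+ n.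

(** [P] is a tuple of homogeneous coordinates of a point of the curve. *)
Definition fermat_point (K : fieldType) (n : nat) (P : 'I_3 -> K) : Prop :=
  (exists i, P i != 0) /\ (fermat_form K n).@[P] = 0.

(** Value of a homogeneous polynomial [G(X, Y, Z)] at the generic point [(x : y : 1)]. *)
Definition at_generic (K : fieldType) (n : nat) (X : fermat_curve K n)
    (G : {mpoly K[3]}) : function_field X :=
  mmap (const X) (tnth [tuple coord_x X; coord_y X; 1]) G.

(** The local ring of the curve at [P]. *)
Definition regular_at (K : fieldType) (n : nat) (X : fermat_curve K n)
    (P : 'I_3 -> K) (f : function_field X) : Prop :=
  exists (d : nat) (G H : {mpoly K[3]}),
    [/\ G \is d.-homog, H \is d.-homog, H.@[P] != 0 &
        f = at_generic X G / at_generic X H].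

(** [H^0(X, Omega^1)]: at each point [P], [w] is of the form [sum_i f_i dg_i]
    with [f_i] and [g_i] regular at [P]. *)
Definition holomorphic (K : fieldType) (n : nat) (X : fermat_curve K n)
    (w : form (const X)) : Prop :=
  forall P : 'I_3 -> K, fermat_point n P -> differential_over (regular_at P) w.

(** [a] is the [a]-number of [X], in characteristic [p]. *)
Definition is_a_number (K : fieldType) (n : nat) (X : fermat_curve K n)
    (p a : nat) : Prop :=
  has_dim (fun w : form (const X) => holomorphic w /\ cartier p w 0) a.

(** * Existence of the function field of a Fermat curve *)

Section Existence.

Variables (K : closedFieldType) (n : nat).
Hypothesis n_neq0 : n%:R != 0 :> K.

Let n_gt0 : (0 < n)%N.
Proof. by case: n n_neq0 => //; rewrite eqxx. Qed.

Let c : {poly K} := - ('X^n + 1).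

Let size_c : size c = n.+1.
Proof. by rewrite /c size_polyN -polyC1 size_XnaddC. Qed.

Let c_neq0 : c != 0.
Proof. by rewrite -size_poly_eq0 size_c. Qed.

Let simple_root : exists z, mup z c = 1%N.
Proof.
have /closed_rootP [z rz] : size c != 1%N by rewrite size_c eqSS -lt0n.
exists z; apply/eqP; rewrite eqn_leq -XsubC_dvd // dvdp_XsubCl rz andbT.
rewrite mup_leq //; apply/negP=> /dvdpP [q cE].
have zn : z ^+ n = -1.
  move: rz; rewrite /root /c hornerN hornerD hornerXn hornerC oppr_eq0.
  by rewrite addr_eq0 => /eqP.
have: (c^`()).[z] = 0.
  rewrite cE expr2 !derivM.
  by rewrite !(hornerXsubC, hornerD, hornerM, subrr, mulr0, mul0r, addr0).
rewrite /c derivN derivD derivXn derivC addr0 hornerN hornerMn hornerXn.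
move/eqP; rewrite oppr_eq0 -mulr_natl mulf_eq0 (negPf n_neq0) /=.
case: n n_gt0 zn => // k _ zn /eqP zk; move/eqP: zn.
by rewrite exprS zk mulr0 eq_sym oppr_eq0 oner_eq0.
Qed.

Section FractionField.

(* Keeping the fraction field abstract avoids unfolding it in unification. *)
Variables (F : fieldType) (t : {rmorphism {poly K} -> F}).
Hypothesis t_inj : injective t.
Hypothesis fracP : forall f : F, exists q r, r != 0 /\ f = t q / t r.

Let h : {poly F} := 'X^n - (t c)%:P.

Let h_monic : h \is monic.
Proof. exact: monicXnsubC. Qed.

Let size_h : size h = n.+1.
Proof. exact: size_XnsubC. Qed.

Let h_irreducible : irreducible_poly h.
Proof.
split=> [|q q_size q_h]; first by rewrite size_h ltnS.
have h0 : h != 0 by rewrite monic_neq0.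
have q0 : q != 0 by apply: contraNneq h0 => q0; rewrite -dvd0p -q0.
pose g := (lead_coef q)^-1 *: q.
have lq0 : lead_coef q != 0 by rewrite lead_coef_eq0.
have lqV0 : (lead_coef q)^-1 != 0 by rewrite invr_eq0.
have gm : g \is monic by apply/monicP; rewrite lead_coefZ; apply: mulVf.
have gq : g %= q by rewrite eqp_scale.
rewrite -(eqp_ltrans gq).
have gh : g %| h by rewrite (eqp_dvdl _ gq).
have [d sg] : exists d, size g = d.+2.
  have: size g != 1%N by rewrite size_scale.
  have: size g != 0%N by rewrite size_poly_eq0 monic_neq0.
  by case: (size g) => [|[|d]] // _ _; exists d.
have [A gA] : exists A : 'M[F]_d.+1, char_poly A = g.
  have := companionmxK gm; move: (companionmx _); rewrite sg => A.
  by exists A.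
have hA : horner_mx A h = 0.
  case/dvdpP: gh => r ->; rewrite rmorphM /= -gA.
  by rewrite Cayley_Hamilton mulr0.
have An : A ^+ n = ((t c))%:M.
  move: hA; rewrite rmorphB /= rmorphXn /= horner_mx_X horner_mx_C.
  by move/eqP; rewrite subr_eq0 => /eqP.
have dA : (\det A) ^+ n = (t c) ^+ d.+1.
  rewrite -(det_scalar d.+1) -An; elim: n => [|k IH]; first by rewrite !expr0 det1.
  by rewrite !exprS IH detM.
have [a [b [b0 dE]]] := fracP (\det A).
have ab : a ^+ n = c ^+ d.+1 * b ^+ n.
  apply: t_inj; rewrite rmorphM !rmorphXn /= -dA dE expr_div_n.
  by rewrite divfK // expf_neq0 // -(rmorph0 t) (inj_eq t_inj).
have [z mz] := simple_root.
have a0 : a != 0.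
  have : a ^+ n != 0 by rewrite ab mulf_neq0 // expf_neq0.
  by rewrite expf_eq0 n_gt0.
have mupX q1 k : q1 != 0 -> mup z (q1 ^+ k) = (k * mup z q1)%N.
  move=> q10; elim: k => [|k IH]; first by rewrite mupNroot // root1.
  by rewrite exprS mupM ?expf_neq0 // IH mulSn.
have: (n * mup z a = d.+1 * mup z c + n * mup z b)%N.
  by rewrite -!mupX // ab mupM ?expf_neq0.
rewrite mz muln1; move/(congr1 (fun m => n %| m)%N).
rewrite dvdn_mulr // dvdn_addl ?dvdn_mulr // => /esym /dvdn_leq -/(_ isT) nd.
rewrite -dvdp_size_eqp // eqn_leq dvdp_leq //=.
by rewrite size_h sg ltnS.
Qed.

Let quotient_field : exists (L : fieldType) (e : {rmorphism F -> L}) (y : L),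
  y ^+ n = e (t c) /\ forall f, exists q, f = (map_poly e q).[y].
Proof.
have hI : monic_irreducible_poly h := (h_irreducible, h_monic).
have hE : mk_monic h = h := mk_monicE hI.
pose e : {rmorphism F -> {poly %/ h}} := qpolyC h.
pose y : {poly %/ h} := in_qpoly h 'X.
have eE q : (map_poly e q).[y] = in_qpoly h q.
  elim/poly_ind: q => [|q k IH]; first by rewrite !rmorph0 horner0.
  rewrite rmorphD rmorphM /= map_polyX map_polyC hornerD hornerM hornerX hornerC.
  rewrite IH rmorphD rmorphM /=; congr (_ + _); apply/val_inj.
  rewrite /= rmodp_small // (leq_ltn_trans (size_polyC_leq1 k)) //.
  exact: size_mk_monic_gt1.
exists {poly %/ h with hI}, e, y; split; last first.
  move=> f; exists (val f); rewrite eE; apply/val_inj.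
  exact/esym/rmodp_small/size_mk_monic.
apply/eqP; rewrite -subr_eq0; apply/eqP.
have <- : in_qpoly h h = 0 by apply/val_inj; rewrite /= hE rmodpp.
rewrite -eE rmorphB /= map_polyXn map_polyC hornerD hornerN.
by rewrite hornerXn hornerC.
Qed.

Lemma fermat_curve_of_fractions : inhabited (fermat_curve K n).
Proof.
have [L [qC [y [yn gen]]]] := quotient_field.
pose emb : {rmorphism K -> L} := qC \o t \o polyC.
pose x : L := qC (t 'X).
have embE q : (map_poly emb q).[x] = qC (t q).
  elim/poly_ind: q => [|q k IH]; first by rewrite !rmorph0 horner0.
  rewrite rmorphD rmorphM /= map_polyX map_polyC hornerD hornerM hornerX hornerC.
  by rewrite IH !rmorphD !rmorphM.
have eq_xy : x ^+ n + y ^+ n + 1 = 0.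
  rewrite yn /x /c -rmorphXn /= -rmorphXn /= rmorphN rmorphD rmorph1.
  by rewrite rmorphN rmorphD rmorph1 opprD addrA subrr add0r addNr.
constructor; refine (@FermatCurve K n L emb x y eq_xy _ _).
- move=> q; rewrite embE => q0; apply: t_inj; apply: (fmorph_inj qC).
  by rewrite q0 !rmorph0.
- pose e := @mmap 2 K L emb (tnth [tuple x; y]).
  have repr_mul f g : (exists G H, f = e G / e H) ->
     (exists G H, g = e G / e H) -> exists G H, f * g = e G / e H.
    move=> [G1 [H1 ->]] [G2 [H2 ->]]; exists (G1 * G2), (H1 * H2).
    by rewrite /e !rmorphM /= invfM mulrACA.
  have repr_add f g : (exists G H, f = e G / e H) ->
     (exists G H, g = e G / e H) -> exists G H, f + g = e G / e H.
    move=> [G1 [H1 ->]] [G2 [H2 ->]].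
    have [->|H10] := eqVneq (e H1) 0.
      by exists G2, H2; rewrite invr0 mulr0 add0r.
    have [->|H20] := eqVneq (e H2) 0.
      by exists G1, H1; rewrite invr0 mulr0 addr0.
    exists (G1 * H2 + G2 * H1), (H1 * H2).
    by rewrite addf_div // /e rmorphD !rmorphM.
  have e1 : e 1 = 1 by rewrite /e rmorph1.
  have repr_x : forall r, exists G, qC (t r) = e G.
    move=> r.
    exists (map_poly (@mpolyC 2 K) r).['X_0].
    pose E : {rmorphism {mpoly K[2]} -> L} := e.
    rewrite -embE; transitivity (map_poly E (map_poly (@mpolyC 2 K) r)).[E 'X_0].
      rewrite -map_poly_comp /= /e mmapX mmap1U; congr (_.[_]).
      by apply: eq_map_poly => k /=; rewrite mmapC.
    exact: horner_map.
  have repr_F (f : F) : exists G H, qC f = e G / e H.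
    have [a [b [_ ->]]] := fracP f.
    have [[G GE] [H HE]] := (repr_x a, repr_x b).
    by exists G, H; rewrite fmorph_div /= GE HE.
  move=> f.
  have [q ->] := gen f.
  rewrite horner_coef.
  elim/big_ind: _ => [|g1 g2|i _].
  + by exists 0, 1; rewrite /e rmorph0 mul0r.
  + exact: repr_add.
  + rewrite coef_map; apply: repr_mul; first exact: repr_F.
    exists ('X_1 ^+ i), 1; rewrite e1 divr1 /e rmorphXn /=.
    by rewrite mmapX mmap1U.
Qed.

End FractionField.

Local Notation F := {fraction {poly K}}.
Local Notation "q %:F" := (@FracField.tofrac {poly K} q).

Let fracP (f : F) : exists q r, r != 0 /\ f = q%:F / r%:F.
Proof.
elim/quotW: f => f; exists (\n_f), (\d_f); split; first exact: denom_ratioP.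
apply: (canRL (mulfK _)); first by rewrite tofrac_eq0 denom_ratioP.
rewrite !piE; apply/eqP; rewrite piE /= FracField.equivfE /FracField.mulf.
rewrite !numden_Ratio ?oner_eq0 ?mulr1 ?denom_ratioP //.
by rewrite mulrC.
Qed.

Lemma fermat_curve_inhabited : inhabited (fermat_curve K n).
Proof.
apply: (@fermat_curve_of_fractions F (@FracField.tofrac {poly K}));
  last exact: fracP.
by move=> q r /eqP; rewrite tofrac_eq => /eqP.
Qed.

End Existence.

(* Main.v *)
(** Let [n = s p + 1].  A holomorphic form is regular on the affine part of the
    curve and on the chart [u = 1/x], [v = y/x]; comparing the two expansions
    in powers of [y] shows that it is a combination of the forms
    [x^i y^j dx / y^(n-1)] with [i + j <= n - 3].  Since
    [y y^(s p) = - 1 - x x^(s p)], the function [y] is affine in [x] over the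
    field of [p]-th powers, so the Cartier operator sends
    [x^(i1 p + i0) y^(j1 p + j0) dx / y^(s p)], where [i0, j0 < p], to a
    constant multiple of
    [x^(i1 + s (p-1-i0)) y^(j1 + s (p-1-j0)) dx / y^(s p)].  The constant is
    a binomial coefficient which vanishes exactly when [i0 + j0 <= p - 2], and
    these images are distinct monomials whose [y]-degree is less than [n], hence
    linearly independent.  The kernel is thus spanned by the forms with
    [i0 + j0 <= p - 2] and [i1 + j1 <= s - 1]. *)

From HB Require Import structures.
From mathcomp Require Import all_boot all_algebra ring zify boolp functions mpoly.
Require Import Defs.
Set Implicit Arguments.
Unset Strict Implicit.
Unset Printing Implicit Defensive.
Import GRing.Theory.
Local Open Scope ring_scope.

(** * Evaluation of bivariate polynomials at the generic point *)

Section BivariateEvaluation.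

Variables (K L : fieldType) (iota : {rmorphism K -> L}) (x y : L).

(** A form is a priori only a function on derivations, so everything is tested on one derivation [D]
    with [D x = 1], of which every other is a multiple. Regularity is given point by point, through
    local denominators; it becomes polynomiality because [K[x, y]] is the intersection of its local
    rings. Comparing coefficients needs [1, y, ..., y^(n-1)] independent over [K(x)]: this is
    Eisenstein's argument at a simple root of [X^n + 1], run in the integral closure of [K[x]]
    instead of with a valuation. The Cartier operator may be computed with any separating element,
    so its kernel is compared with the expansion in [x] through exactness. Expansions over p-th
    powers are evaluations at [x] of polynomials over [L] with Frobenius acting on coefficients, so
    the lemmas on [evx] serve there as well. *)

Definition evx (q : {poly K}) : L := (map_poly iota q).[x].

HB.instance Definition _ :=
  GRing.RMorphism.copy evx (horner_eval x \o map_poly iota).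

Definition ev (G : {poly {poly K}}) : L := (map_poly evx G).[y].

HB.instance Definition _ :=
  GRing.RMorphism.copy ev (horner_eval y \o map_poly evx).

Lemma evxC c : evx c%:P = iota c.
Proof. by rewrite /evx map_polyC hornerC. Qed.

Lemma evxX : evx 'X = x.
Proof. by rewrite /evx map_polyX hornerX. Qed.

Lemma evC q : ev q%:P = evx q.
Proof. by rewrite /ev map_polyC hornerC. Qed.

Lemma evX : ev 'X = y.
Proof. by rewrite /ev map_polyX hornerX. Qed.

Lemma evM G H : ev (G * H) = ev G * ev H.
Proof. exact: rmorphM. Qed.

Lemma evB G H : ev (G - H) = ev G - ev H.
Proof. exact: rmorphB. Qed.

Lemma evCX k : ev ('X^k)%:P = x ^+ k.
Proof. by rewrite evC rmorphXn /= evxX. Qed.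

Lemma evXn k : ev 'X^k = y ^+ k.
Proof. by rewrite rmorphXn /= evX. Qed.

Lemma ev_coef (m : nat) (G : {poly {poly K}}) :
  (size G <= m)%N -> ev G = \sum_(i < m) evx G`_i * y ^+ i.
Proof.
move=> sG; rewrite /ev (@horner_coef_wide _ m).
  by apply: eq_bigr => i _; rewrite coef_map.
exact: leq_trans (size_poly _ _) sG.
Qed.

Hypothesis x_transc : forall q : {poly K}, (map_poly iota q).[x] = 0 -> q = 0.

Lemma evx_inj : injective evx.
Proof.
by move=> q r /eqP; rewrite -subr_eq0 -rmorphB => /eqP/x_transc/subr0_eq.
Qed.

Variable x0 : K.

Local Notation pi := (evx ('X - x0%:P)).

(** The ideal generated by [X - x0] in the integral closure of [K[x]] in [L]. *)
Definition integral_multiple (z : L) : Prop :=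
  exists2 z', integralOver evx z' & z = pi * z'.

Lemma integral_multipleD z w :
  integral_multiple z -> integral_multiple w -> integral_multiple (z + w).
Proof.
move=> [z1 Iz ->] [w1 Iw ->]; exists (z1 + w1); last by rewrite mulrDr.
exact: integral_add.
Qed.

Lemma integral_multipleM z w :
  integral_multiple z -> integralOver evx w -> integral_multiple (z * w).
Proof.
move=> [z1 Iz ->] Iw; exists (z1 * w); last by rewrite mulrA.
exact: integral_mul.
Qed.

Lemma integral_multiple_sum (I : Type) (r : seq I) (P : pred I) (F : I -> L) :
  (forall i, P i -> integral_multiple (F i)) ->
  integral_multiple (\sum_(i <- r | P i) F i).
Proof.
move=> FP; apply: big_ind => //; last exact: integral_multipleD.
by exists 0; [exact: integral0 | rewrite mulr0].
Qed.

Lemma integral_exp z k : integralOver evx z -> integralOver evx (z ^+ k).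
Proof.
move=> Iz; elim: k => [|k IH]; first by rewrite expr0; exact: integral1.
by rewrite exprS; exact: integral_mul.
Qed.

Lemma integral_multiple_evx (q : {poly K}) :
  q.[x0] = 0 -> integral_multiple (evx q).
Proof.
move=> q0; have /factor_theorem [r ->] : root q x0 by apply/eqP.
exists (evx r); first exact: integral_id.
by rewrite rmorphM /= mulrC.
Qed.

(* Clearing denominators in an integral equation of [evx q / pi] and reducing
   it modulo [X - x0] leaves a power of [q(x0)]. *)
Lemma evx_integral_multiple (q : {poly K}) :
  integral_multiple (evx q) -> q.[x0] = 0.
Proof.
move=> [z [P mP rP] qz].
have [N sP] : exists N, size P = N.+1.
  by exists (size P).-1; rewrite prednK // lt0n size_poly_eq0 monic_neq0.
pose T := \sum_(i < N.+1) P`_i * q ^+ i * ('X - x0%:P) ^+ (N - i).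
have T0 : T = 0.
  apply: evx_inj; rewrite rmorph0 rmorph_sum /=.
  move/rootP: rP; rewrite (@horner_coef_wide _ N.+1) => [E|]; last first.
    by rewrite -sP size_poly.
  transitivity (pi ^+ N * \sum_(i < N.+1) (map_poly evx P)`_i * z ^+ i);
    last by rewrite E mulr0.
  rewrite mulr_sumr; apply: eq_bigr => i _.
  rewrite coef_map 2!rmorphM !rmorphXn /= qz exprMn.
  have -> : pi ^+ N = pi ^+ i * pi ^+ (N - i).
    by rewrite -exprD subnKC // -ltnS.
  by ring.
have := congr1 (fun r => r.[x0]) T0.
rewrite /T horner_sum big_ord_recr /= big1 => [|i _]; last first.
  rewrite hornerM horner_exp hornerXsubC subrr expr0n subn_eq0.
  by rewrite leqNgt ltn_ord mulr0.
rewrite add0r subnn mulr1 hornerM horner_exp horner0.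
move/monicP: mP; rewrite /lead_coef sP /= => ->.
by rewrite hornerC mul1r => /eqP; rewrite expf_eq0 => /andP[_ /eqP].
Qed.

End BivariateEvaluation.

(** With [idfun] on coefficients, [evx] and [ev] evaluate at points over [K]; closed points and the
    generic point thus share the same lemmas. *)
Lemma evx_idfun (K : fieldType) (x0 : K) (q : {poly K}) :
  evx (idfun : {rmorphism K -> K}) x0 q = q.[x0].
Proof. by rewrite /evx map_poly_id. Qed.

(** * Independence of the powers of [y] over [K(x)] *)

Section FermatEquation.

Variables (K : closedFieldType) (L : fieldType) (iota : {rmorphism K -> L}).
Variables (n : nat) (x y : L).
Hypothesis n_neq0 : n%:R != 0 :> K.
Hypothesis fermat_xy : x ^+ n + y ^+ n + 1 = 0.
Hypothesis x_transc : forall q : {poly K}, (map_poly iota q).[x] = 0 -> q = 0.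

Local Notation evx := (evx iota x).
Local Notation ev := (ev iota x y).

Lemma exponent_gt0 : (0 < n)%N.
Proof. by case: n n_neq0 => //; rewrite eqxx. Qed.

Lemma fermat_affine_point : exists y1 : K, 0 ^+ n + y1 ^+ n + 1 = 0.
Proof.
have /closed_rootP [y1 /rootP ry] : size ('X^n + 1 : {poly K}) != 1%N.
  by rewrite -polyC1 size_XnaddC ?exponent_gt0 // eqSS -lt0n exponent_gt0.
exists y1; rewrite expr0n eqn0Ngt exponent_gt0 add0r.
by move: ry; rewrite hornerD hornerXn hornerC.
Qed.

(** A root of [X^n + 1] is simple because the derivative there is [n x0^(n-1)], nonzero in [K].
    Hence the curve equation is Eisenstein at [X - x0]. *)
Lemma fermat_ramified : exists (x0 : K) (c : {poly K}),
  'X^n + 1 = ('X - x0%:P) * c /\ c.[x0] != 0.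
Proof.
have [x0 r0] : exists x0, root ('X^n + 1 : {poly K}) x0.
  apply/closed_rootP; rewrite -polyC1 size_XnaddC ?exponent_gt0 //.
  by rewrite eqSS -lt0n exponent_gt0.
have /factor_theorem [c cE] := r0; exists x0, c; split; first by rewrite mulrC.
have xn : x0 ^+ n = -1.
  by move/eqP: r0; rewrite hornerD hornerXn hornerC => /eqP; rewrite addr_eq0 => /eqP.
have := congr1 (fun q : {poly K} => q^`().[x0]) cE.
rewrite derivM derivD derivXn derivXsubC derivC addr0 hornerMn hornerXn.
rewrite hornerD !hornerM hornerXsubC subrr mulr0 add0r hornerC mulr1 => <-.
rewrite -mulr_natl mulf_neq0 //.
apply/eqP => e0; move: xn; rewrite -(prednK exponent_gt0) exprS e0 mulr0.
by move/eqP; rewrite eq_sym oppr_eq0 oner_eq0.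
Qed.

Lemma y_integral : integralOver evx y.
Proof.
exists ('X^n + ('X^n + 1)%:P); first by apply: monicXnaddC; exact: exponent_gt0.
apply/rootP; rewrite rmorphD /= map_polyXn map_polyC hornerD hornerXn hornerC.
by rewrite /= rmorphD rmorphXn rmorph1 /= evxX addrA [y ^+ n + _]addrC.
Qed.

(* Eisenstein's argument at a point where [y] vanishes. *)
Lemma ev_coef_root (x0 : K) (c : {poly K}) (G : {poly {poly K}}) (b : nat) :
  'X^n + 1 = ('X - x0%:P) * c -> c.[x0] != 0 ->
  (size G <= n)%N -> ev G = 0 -> (G`_b).[x0] = 0.
Proof.
move=> cE c0 sG G0; have n_gt0 := exponent_gt0.
have yn : y ^+ n = - evx ('X^n + 1).
  rewrite rmorphD rmorphXn rmorph1 /= evxX; apply/eqP.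
  by rewrite -addr_eq0 addrC addrAC fermat_xy.
have Jyn : integral_multiple iota x x0 (y ^+ n).
  rewrite yn -rmorphN; apply: integral_multiple_evx.
  by rewrite hornerN cE hornerM hornerXsubC subrr mul0r oppr0.
elim/ltn_ind: b => b IH.
have [nb|bn] := leqP n b.
  by rewrite nth_default ?horner0 // (leq_trans sG).
(* Multiplying the relation by [y^(n-1-b)] isolates term [b]: coefficients below [b] vanish at [x0]
   by induction, and terms above [b] acquire the factor [y^n], a multiple of [X - x0]. *)
have Jb : integral_multiple iota x x0 (evx G`_b * y ^+ n.-1).
  pose F i := evx G`_i * y ^+ (i + (n.-1 - b)).
  have E : \sum_(i < n) F i = 0.
    transitivity (ev G * y ^+ (n.-1 - b)); last by rewrite G0 mul0r.
    rewrite (ev_coef _ _ _ sG) mulr_suml; apply: eq_bigr => i _.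
    by rewrite -mulrA -exprD.
  move: E; rewrite (bigD1 (Ordinal bn)) //= {1}/F subnKC; last first.
    by rewrite -ltnS prednK.
  move/eqP; rewrite addr_eq0 => /eqP ->.
  rewrite -mulrN1; apply: integral_multipleM; last first.
    by apply: integral_opp; exact: integral1.
  apply: integral_multiple_sum => i neq_ib.
  have [ltib|leib] := ltnP i b.
    apply: integral_multipleM; first exact/integral_multiple_evx/IH.
    by apply: integral_exp; exact: y_integral.
  have ltbi : (b < i)%N.
    rewrite ltn_neqAle leib andbT eq_sym.
    by apply: contra neq_ib => /eqP ib; apply/eqP/val_inj.
  rewrite /F; have -> : (i + (n.-1 - b) = n + (i - b.+1))%N.
    rewrite addnBA; last by rewrite -ltnS prednK.
    by rewrite addnBA // -subn1 addnBA // addnC -subnDA add1n.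
  rewrite exprD mulrCA; apply: integral_multipleM => //.
  apply: integral_mul; first exact: integral_id.
  by apply: integral_exp; exact: y_integral.
have [z Iz zE] := Jb.
have pi0 : evx ('X - x0%:P) != 0.
  by rewrite -(rmorph0 evx) (inj_eq (evx_inj x_transc)) polyXsubC_eq0.
(* Since [y^n = - (x - x0) c(x)], the [n]-th power of [zE] can be divided by [(x - x0)^(n-1)], which
   leaves one factor [x - x0]. *)
have : integral_multiple iota x x0 (evx (G`_b ^+ n * (- c) ^+ n.-1)).
  exists (z ^+ n); first exact: integral_exp.
  apply: (mulfI (expf_neq0 n.-1 pi0)).
  rewrite mulrA -exprSr prednK // -exprMn -zE exprMn exprAC yn cE.
  by rewrite !rmorphM !rmorphXn rmorphN /= -mulrN exprMn mulrCA.
move/evx_integral_multiple => /(_ x_transc)/eqP.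
rewrite hornerM !horner_exp hornerN mulf_eq0 !expf_eq0 oppr_eq0 (negPf c0) andbF orbF.
by case/andP => _ /eqP.
Qed.

(** Descent: [X - x0] divides every coefficient and the quotient again evaluates to zero, so the
    degree of a nonzero coefficient could be lowered forever. *)
Lemma ev_inj_size (G : {poly {poly K}}) : (size G <= n)%N -> ev G = 0 -> G = 0.
Proof.
have [x0 [c [cE c0]]] := fermat_ramified.
move=> sG G0; apply/polyP => b; rewrite coef0.
elim: {G}(size G`_b) {-2}G (leqnn (size G`_b)) sG G0 => [|k IH] G sGb sG G0.
  by apply/eqP; rewrite -size_poly_leq0.
have Groot i : root G`_i x0 by apply/eqP; exact: ev_coef_root cE c0 sG G0.
pose G' := \poly_(i < n) (G`_i %/ ('X - x0%:P)).
have GE : G = ('X - x0%:P)%:P * G'.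
  apply/polyP => i; rewrite coefCM coef_poly; case: ltnP => ni.
    by rewrite mulrC divpK // dvdp_XsubCl.
  by rewrite nth_default ?mulr0 // (leq_trans sG).
have pi0 : evx ('X - x0%:P) != 0.
  by rewrite -(rmorph0 evx) (inj_eq (evx_inj x_transc)) polyXsubC_eq0.
have G'0 : ev G' = 0.
  move/eqP: G0; rewrite GE rmorphM /= evC mulf_eq0 (negPf pi0) /=.
  by move/eqP.
rewrite GE coefCM (IH G') ?mulr0 ?size_poly //.
have [->|Gb0] := eqVneq G'`_b 0; first by rewrite size_poly0.
move: sGb; rewrite {1}GE coefCM size_monicM ?monicXsubC //.
by rewrite size_XsubC.
Qed.

Definition fermat_poly : {poly {poly K}} := 'X^n + ('X^n + 1)%:P.

Lemma fermat_poly_monic : fermat_poly \is monic.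
Proof. by apply: monicXnaddC; exact: exponent_gt0. Qed.

Lemma size_fermat_poly : size fermat_poly = n.+1.
Proof. by rewrite size_XnaddC ?exponent_gt0. Qed.

Lemma ev_fermat_poly : ev fermat_poly = 0.
Proof.
rewrite rmorphD rmorphXn /= evX evC rmorphD rmorphXn rmorph1 /= evxX.
by rewrite addrA [y ^+ n + _]addrC.
Qed.

Lemma ev_rmodp (G : {poly {poly K}}) :
  ev G = ev (Pdiv.Ring.rmodp G fermat_poly).
Proof.
rewrite {1}(Pdiv.RingMonic.rdivp_eq fermat_poly_monic G) rmorphD rmorphM /= ev_fermat_poly.
by rewrite mulr0 add0r.
Qed.

Lemma ev_kernel (G : {poly {poly K}}) :
  ev G = 0 -> exists Q, G = Q * fermat_poly.
Proof.
rewrite ev_rmodp => /ev_inj_size G0; exists (Pdiv.Ring.rdivp G fermat_poly).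
rewrite {1}(Pdiv.RingMonic.rdivp_eq fermat_poly_monic G) G0 ?addr0 //.
by rewrite -ltnS -size_fermat_poly Pdiv.Ring.ltn_rmodp monic_neq0 ?fermat_poly_monic.
Qed.

Lemma ev_reduce (G : {poly {poly K}}) :
  exists2 N : {poly {poly K}}, (size N <= n)%N & ev G = ev N.
Proof.
exists (Pdiv.Ring.rmodp G fermat_poly); last exact: ev_rmodp.
by rewrite -ltnS -size_fermat_poly Pdiv.Ring.ltn_rmodp monic_neq0 ?fermat_poly_monic.
Qed.

Lemma y_neq0 : y != 0.
Proof.
have n_gt0 := exponent_gt0.
apply/eqP => y0; have := fermat_xy; rewrite y0 expr0n eqn0Ngt n_gt0 addr0 => E.
have /x_transc/eqP : (map_poly iota ('X^n + 1)).[x] = 0.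
  by rewrite rmorphD rmorph1 /= map_polyXn hornerD hornerXn hornerC.
by rewrite -size_poly_eq0 -polyC1 size_XnaddC.
Qed.

Lemma x_neq0 : x != 0.
Proof.
apply/eqP => x0; have /x_transc/eqP : (map_poly iota 'X).[x] = 0.
  by rewrite map_polyX hornerX.
by rewrite polyX_eq0.
Qed.

(* [B] is the constant coefficient of an integral equation of [ev H]. *)
Lemma ev_norm (H : {poly {poly K}}) : ev H != 0 ->
  exists2 B : {poly K}, B != 0 & exists H', ev (H * H') = evx B.
Proof.
move=> H0.
have IH : integralOver evx (ev H).
  rewrite (ev_coef _ _ _ (leqnn _)).
  apply: big_ind => [||i _]; first exact: integral0.
    by move=> u v; exact: integral_add.
  apply: integral_mul; first exact: integral_id.
  by apply: integral_exp; exact: y_integral.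
have [P mP /rootP rP] := IH.
have P0 : P != 0 by rewrite monic_neq0.
elim/poly_ind: P P0 rP {mP} => [|Q c IHQ]; first by rewrite eqxx.
rewrite rmorphD rmorphM /= map_polyX map_polyC hornerMXaddC.
have [->|c0 _ E] := eqVneq c 0.
  rewrite polyC0 raddf0 !addr0 => Q0 /eqP.
  rewrite mulf_eq0 (negPf H0) orbF => /eqP; apply: IHQ.
  by apply: contraNneq Q0 => ->; rewrite mul0r.
exists c => //; exists (- (map_poly polyC Q).[H]).
rewrite rmorphM rmorphN /= -horner_map -map_poly_comp.
rewrite (eq_map_poly (g := evx)) => [|q]; last by rewrite /= evC.
by apply/eqP; rewrite mulrN eq_sym -addr_eq0 addrC mulrC E.
Qed.

End FermatEquation.

(** * Derivations of the function field *)

Section ExtendDerivation.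

Variables (A : comNzRingType) (L : fieldType) (phi : {rmorphism A -> L}).
Variable delta : A -> L.
Hypothesis deltaD : forall a b, delta (a + b) = delta a + delta b.
Hypothesis deltaM : forall a b, delta (a * b) = phi a * delta b + phi b * delta a.
Hypothesis delta_ker : forall a, phi a = 0 -> delta a = 0.
Hypothesis fracP : forall f : L, exists a b, phi b != 0 /\ f = phi a / phi b.

Lemma extend_derivation : exists D : L -> L,
  [/\ forall f g, D (f + g) = D f + D g,
      forall f g, D (f * g) = f * D g + g * D f &
      forall a, D (phi a) = delta a].
Proof.
have /boolp.choice [N NP] : forall f, exists ab : A * A,
    phi ab.2 != 0 /\ f * phi ab.2 = phi ab.1.
  by move=> f; have [a [b [b0 fE]]] := fracP f; exists (a, b); split=> //=; rewrite fE divfK.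
pose D f := (delta (N f).1 - f * delta (N f).2) / phi (N f).2.
have deltaB a b : delta (a - b) = delta a - delta b.
  by apply/eqP; rewrite eq_sym subr_eq -deltaD subrK.
have DP f a b : f * phi b = phi a -> D f * phi b + f * delta b = delta a.
  move=> fE; have [b0 f0] := NP f; rewrite /D.
  move: b0 f0; case: (N f) => a0 b0 /= nz f0.
  have : delta (a * b0 - a0 * b) = 0.
    by apply: delta_ker; rewrite rmorphB !rmorphM /= -fE -f0 mulrAC subrr.
  rewrite deltaB !deltaM -fE -f0 => E.
  apply: (mulfI nz); rewrite !mulrDr.
  transitivity (phi b * (delta a0 - f * delta b0) + phi b0 * (f * delta b)).
    by congr (_ + _); field.
  apply/eqP; rewrite -subr_eq0 -oppr_eq0 -E; apply/eqP; ring.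
have D1 f : exists a b, [/\ phi b != 0, f * phi b = phi a & D f * phi b + f * delta b = delta a].
  have [b0 fE] := NP f; exists (N f).1, (N f).2; split=> //; exact: DP.
exists D; split.
- move=> f g; have [a [b [b0 fE Df]]] := D1 f; have [c [d [d0 gE Dg]]] := D1 g.
  have := @DP (f + g) (a * d + c * b) (b * d).
  rewrite rmorphD !rmorphM /= -fE -gE deltaD !deltaM -Df -Dg -fE -gE.
  move=> /(_ ltac:(ring)) E.
  apply: (mulIf b0); apply: (mulIf d0).
  apply: (addIr ((f + g) * (phi b * delta d + phi d * delta b))).
  by rewrite -[X in X + _ = _]mulrA E; ring.
- move=> f g; have [a [b [b0 fE Df]]] := D1 f; have [c [d [d0 gE Dg]]] := D1 g.
  have := @DP (f * g) (a * c) (b * d).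
  rewrite !rmorphM /= -fE -gE !deltaM -Df -Dg -fE -gE.
  move=> /(_ ltac:(ring)) E.
  apply: (mulIf b0); apply: (mulIf d0).
  apply: (addIr (f * g * (phi b * delta d + phi d * delta b))).
  by rewrite -[X in X + _ = _]mulrA E; ring.
- move=> a; have := @DP (phi a) a 1; rewrite rmorph1 !mulr1 => /(_ erefl).
  have -> : delta 1 = 0.
    have := deltaM 1 1; rewrite rmorph1 !mul1r => E.
    by apply: (addrI (delta 1)); rewrite addr0 -E.
  by rewrite mulr0 addr0.
Qed.

End ExtendDerivation.

Lemma rmorph_mmap (k : nat) (R S T : comNzRingType) (g : {rmorphism S -> T})
    (f : {rmorphism R -> S}) (f' : R -> T) (h : 'I_k -> S) (h' : 'I_k -> T) (G : {mpoly R[k]}) :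
  (forall c, f' c = g (f c)) -> (forall i, h' i = g (h i)) ->
  g (mmap f h G) = mmap f' h' G.
Proof.
move=> ff hh; rewrite /mmap rmorph_sum; apply: eq_bigr => m _.
rewrite rmorphM ff; congr (_ * _); rewrite /mmap1 rmorph_prod.
by apply: eq_bigr => i _; rewrite rmorphXn hh.
Qed.

Lemma mmap_dhomog (k d : nat) (R : nzRingType) (S : comNzRingType) (f : R -> S)
    (h : 'I_k -> S) (c : S) (G : {mpoly R[k]}) :
  G \is d.-homog -> mmap f (fun i => c * h i) G = c ^+ d * mmap f h G.
Proof.
move=> /dhomogP hG; rewrite /mmap mulr_sumr !big_seq; apply: eq_bigr => m mG.
rewrite mulrCA; congr (_ * _).
rewrite -(hG m mG) /= mdegE -prodrXr /mmap1 -big_split /=.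
by apply: eq_bigr => i _; rewrite exprMn.
Qed.

Lemma map_poly_deriv_mul (R : nzRingType) (G H : {poly {poly R}}) :
  map_poly deriv (G * H) = map_poly deriv G * H + G * map_poly deriv H.
Proof.
apply/polyP => i; rewrite coefD !coefM coef_map coefM raddf_sum -big_split /=.
by apply: eq_bigr => j _; rewrite !coef_map /= derivM.
Qed.

Section FermatDerivation.

Variables (K : closedFieldType) (L : fieldType) (iota : {rmorphism K -> L}).
Variables (n : nat) (x y : L).
Hypothesis n_neq0 : n%:R != 0 :> K.
Hypothesis fermat_xy : x ^+ n + y ^+ n + 1 = 0.
Hypothesis x_transc : forall q : {poly K}, (map_poly iota q).[x] = 0 -> q = 0.
Hypothesis gen : forall f : L, exists G H : {mpoly K[2]},
  f = mmap iota (tnth [tuple x; y]) G / mmap iota (tnth [tuple x; y]) H.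

Local Notation evx := (evx iota x).
Local Notation ev := (ev iota x y).

Lemma ev_mmap (G : {mpoly K[2]}) :
  mmap iota (tnth [tuple x; y]) G =
  ev (mmap (polyC \o polyC) (tnth [tuple 'X%:P; 'X]) G).
Proof.
symmetry; apply: (@rmorph_mmap 2 K {poly {poly K}} L ev (polyC \o polyC)) => [c|].
  by rewrite /= evC evxC.
by case=> [[|[|?]] i2] //; rewrite /tnth /= ?evC ?evxX ?evX.
Qed.

Lemma ev_fracP (f : L) : exists G H, ev H != 0 /\ f = ev G / ev H.
Proof.
have [G [H ->]] := gen f; rewrite !ev_mmap; set H' := mmap _ _ H.
have [->|H0] := eqVneq (ev H') 0; last by exists (mmap (polyC \o polyC) (tnth [tuple 'X%:P; 'X]) G), H'.
by exists 0, 1; rewrite rmorph1 oner_neq0 invr0 mulr0 rmorph0 mul0r.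
Qed.

Lemma fermat_derivation : exists D : derivation iota, D x = 1.
Proof.
(* The value of [D y] forced by the curve equation; with it [delta] kills [fermat_poly], hence the
   whole kernel of [ev]. *)
pose dy := - (x / y) ^+ n.-1.
pose delta G := ev (map_poly deriv G) + dy * ev G^`().
have y0 := y_neq0 n_neq0 fermat_xy x_transc.
have deltaM a b : delta (a * b) = ev a * delta b + ev b * delta a.
  by rewrite /delta map_poly_deriv_mul derivM !rmorphD !rmorphM /=; ring.
have delta_fermat : delta (fermat_poly K n) = 0.
  rewrite /delta /fermat_poly derivD derivXn derivC addr0.
  have -> : map_poly deriv (fermat_poly K n) = ('X^(n.-1) *+ n)%:P.
    apply/polyP => i; rewrite coef_map coefD coefXn !coefC /= derivD.
    rewrite -mulrb derivMn -polyC1 derivC mul0rn add0r.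
    by case: eqP => _; rewrite ?deriv0 // derivD derivXn derivC addr0.
  rewrite evC !rmorphMn !rmorphXn /= evX evxX /dy expr_div_n mulrnAr mulNr.
  rewrite divfK ?expf_neq0 //.
  by rewrite mulNrn subrr.
have [|||| D [DD DM Dev]] := @extend_derivation {poly {poly K}} L ev delta.
- by move=> a b; rewrite /delta derivD !rmorphD /=; ring.
- exact: deltaM.
- move=> a /(ev_kernel n_neq0 fermat_xy x_transc) [Q ->].
  rewrite deltaM delta_fermat (ev_fermat_poly _ fermat_xy); ring.
- exact: ev_fracP.
have Dc c : D (iota c) = 0.
  rewrite -(evxC _ x) -(evC _ x y) Dev /delta derivC map_polyC /= derivC.
  by rewrite polyC0 rmorph0; ring.
exists (Derivation DD DM Dc) => /=.
rewrite -(evxX iota x) -(evC _ x y) Dev /delta derivC map_polyC /= derivX.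
by rewrite polyC1 rmorph0 rmorph1; ring.
Qed.

End FermatDerivation.

(** * Derivations and regular functions *)

Section FormEvaluation.

Variables (K L : fieldType) (iota : {rmorphism K -> L}).

Lemma form_scaleE c (w : form iota) D : (c *: w) D = c * w D.
Proof. by []. Qed.

Lemma form_sumE (I : Type) (r : seq I) (P : pred I) (F : I -> form iota) D :
  (\sum_(i <- r | P i) F i) D = \sum_(i <- r | P i) F i D.
Proof. by elim/big_rec2: _ => // i _ u _ <-. Qed.

Lemma form_eqP (w1 w2 : form iota) : (forall D, w1 D = w2 D) -> w1 = w2.
Proof. by move=> E; apply/funext. Qed.

Variable D : derivation iota.

Lemma der0 : D 0 = 0.
Proof. by have := derivation_const D 0; rewrite rmorph0. Qed.

Lemma der1 : D 1 = 0.
Proof. by have := derivation_const D 1; rewrite rmorph1. Qed.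

Lemma der_sum (I : Type) (r : seq I) (P : pred I) (F : I -> L) :
  D (\sum_(i <- r | P i) F i) = \sum_(i <- r | P i) D (F i).
Proof. exact: (big_morph (der_fun D) (derivation_add D) der0). Qed.

Lemma derX f k : D (f ^+ k) = k%:R * f ^+ k.-1 * D f.
Proof.
elim: k => [|k IH]; first by rewrite expr0 der1 !mul0r.
rewrite exprS derivation_mul IH; case: k {IH} => [|k] /=; first by rewrite !expr0; ring.
by rewrite (exprS f k) -(natr1 k.+1); ring.
Qed.

Lemma der_div f g h : h != 0 -> f * h = g -> D f = (D g * h - g * D h) / h ^+ 2.
Proof. by move=> h0 <-; rewrite derivation_mul; field. Qed.

Lemma der_pchar p f : p \in [pchar K] -> D (f ^+ p) = 0.
Proof.
move=> charp; rewrite derX.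
by rewrite -(rmorph_nat iota) (pcharf0 charp) rmorph0 !mul0r.
Qed.

Lemma der_evx x q : D (evx iota x q) = evx iota x q^`() * D x.
Proof.
elim/poly_ind: q => [|q c IH]; first by rewrite deriv0 !rmorph0 der0 mul0r.
rewrite derivMXaddC !rmorphD !rmorphM /= evxC evxX derivation_add derivation_mul.
by rewrite IH derivation_const; ring.
Qed.

Lemma der_ev x y G :
  D (ev iota x y G) = ev iota x y (map_poly deriv G) * D x + ev iota x y G^`() * D y.
Proof.
elim/poly_ind: G => [|G q IH]; first by rewrite deriv0 !raddf0 der0 /= !mul0r addr0.
rewrite derivMXaddC [map_poly _ _]raddfD /= map_poly_deriv_mul !rmorphD !rmorphM /=.
have -> : map_poly deriv ('X : {poly {poly K}}) = 0.
  by apply/polyP => i; rewrite coef_map coefX coef0 /= -polyC_natr derivC.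
rewrite map_polyC /= evC evX evC derivation_add derivation_mul IH der_evx rmorph0 !evC; ring.
Qed.

End FormEvaluation.

(** * Functions regular on an affine chart *)

Section FermatRegular.

Variables (K : closedFieldType) (L : fieldType) (iota : {rmorphism K -> L}).
Variables (n : nat) (x y : L).
Hypothesis n_neq0 : n%:R != 0 :> K.
Hypothesis fermat_xy : x ^+ n + y ^+ n + 1 = 0.
Hypothesis x_transc : forall q : {poly K}, (map_poly iota q).[x] = 0 -> q = 0.

Local Notation ev0 := (ev (idfun : {rmorphism K -> K})).
Local Notation ev0x := (evx (idfun : {rmorphism K -> K})).
Local Notation evx := (evx iota x).
Local Notation ev := (ev iota x y).

(** The local ring at an affine point, for any coordinates satisfying the equation: it serves for
    [x], [y] and again for [1/x], [y/x]. *)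
Definition locally_regular (x0 y0 : K) (f : L) : Prop :=
  exists G H, ev0 x0 y0 H != 0 /\ f * ev H = ev G.

Lemma locally_regularD x0 y0 f g : locally_regular x0 y0 f ->
  locally_regular x0 y0 g -> locally_regular x0 y0 (f + g).
Proof.
move=> [G [H [H0 E]]] [G' [H' [H'0 E']]].
exists (G * H' + G' * H), (H * H'); rewrite rmorphM mulf_neq0 //; split=> //.
by rewrite rmorphD !rmorphM /= -E -E'; ring.
Qed.

Lemma locally_regularM x0 y0 f g : locally_regular x0 y0 f ->
  locally_regular x0 y0 g -> locally_regular x0 y0 (f * g).
Proof.
move=> [G [H [H0 E]]] [G' [H' [H'0 E']]].
exists (G * G'), (H * H'); rewrite rmorphM mulf_neq0 //; split=> //.
by rewrite !rmorphM /= -E -E'; ring.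
Qed.

Lemma locally_regular_ev x0 y0 G : locally_regular x0 y0 (ev G).
Proof. by exists G, 1; rewrite !rmorph1 oner_neq0 mulr1. Qed.

Lemma locally_regular_sum x0 y0 (I : Type) (r : seq I) (P : pred I) (F : I -> L) :
  (forall i, P i -> locally_regular x0 y0 (F i)) ->
  locally_regular x0 y0 (\sum_(i <- r | P i) F i).
Proof.
move=> FP; apply: big_ind => //; last by move=> *; exact: locally_regularD.
by rewrite -(rmorph0 ev); exact: locally_regular_ev.
Qed.

Lemma ev_neq0 x0 y0 H :
  x0 ^+ n + y0 ^+ n + 1 = 0 -> ev0 x0 y0 H != 0 -> ev H != 0.
Proof.
move=> P0; apply: contraNneq => /(ev_kernel n_neq0 fermat_xy x_transc) [Q ->].
by rewrite rmorphM /= ev_fermat_poly ?mulr0.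
Qed.

Lemma der_y (D : derivation iota) : y ^+ n.-1 * D y = - x ^+ n.-1 * D x.
Proof.
have nL : n%:R != 0 :> L by rewrite -(rmorph_nat iota) fmorph_eq0.
apply: (mulfI nL); have := congr1 D fermat_xy.
rewrite !derivation_add !derX der1 der0 => E.
by apply/eqP; rewrite -subr_eq0 -E; apply/eqP; ring.
Qed.

Lemma der_yE (D : derivation iota) : D y = - (x / y) ^+ n.-1 * D x.
Proof.
have y0 := y_neq0 n_neq0 fermat_xy x_transc.
apply: (mulfI (expf_neq0 n.-1 y0)).
rewrite der_y expr_div_n; field; exact: expf_neq0.
Qed.

Lemma der_unique (D D' : derivation iota) : D x = 1 ->
  (forall f : L, exists G H, ev H != 0 /\ f = ev G / ev H) ->
  forall f, D' f = D' x * D f.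
Proof.
move=> Dx gen f; have [G [H [H0 fE]]] := gen f.
have {}fE : f * ev H = ev G by rewrite fE divfK.
rewrite (der_div D H0 fE) (der_div D' H0 fE) !der_ev.
by rewrite !der_yE Dx; field.
Qed.

(** The factor [y^(n-1)] clears the denominator of [D y]: [y^(n-1) D] maps [K[x, y]] to itself, and
    the quotient rule only squares the local denominator. *)
Lemma locally_regular_der (D : derivation iota) x0 y0 f :
  x0 ^+ n + y0 ^+ n + 1 = 0 -> D x = 1 ->
  locally_regular x0 y0 f -> locally_regular x0 y0 (y ^+ n.-1 * D f).
Proof.
move=> P0 Dx [G [H [H0 E]]]; have evH0 := ev_neq0 P0 H0.
pose delta (G : {poly {poly K}}) := 'X^(n.-1) * map_poly deriv G - ('X^(n.-1))%:P * G^`().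
have deltaE A : y ^+ n.-1 * D (ev A) = ev (delta A).
  rewrite /delta evB !evM evCX evXn.
  rewrite der_ev mulrDr Dx mulr1 [in LHS]mulrCA der_y Dx mulr1 mulrN.
  by rewrite [ev _^`() * _]mulrC.
exists (delta G * H - G * delta H), (H * H).
rewrite rmorphM mulf_neq0 //; split=> //.
rewrite evB !evM -!deltaE (der_div D evH0 E).
by field.
Qed.

Lemma differential_locally_regular (S : L -> Prop) (w : form iota)
    (D : derivation iota) x0 y0 :
  x0 ^+ n + y0 ^+ n + 1 = 0 -> D x = 1 ->
  (forall f, S f -> locally_regular x0 y0 f) ->
  differential_over S w -> locally_regular x0 y0 (w D * y ^+ n.-1).
Proof.
move=> P0 Dx Sreg [m [f [g [fgS ->]]]].
rewrite form_sumE mulr_suml; apply: locally_regular_sum => i _.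
rewrite form_scaleE -mulrA; have [Sf Sg] := fgS i.
apply: locally_regularM; first exact: Sreg.
by rewrite mulrC; apply: locally_regular_der => //; exact: Sreg.
Qed.

(* If [x0] is a root of a denominator [B] of [f], then modulo [X - x0] the
   annihilator of the numerator contains [Y^n + x0^n + 1] and, for each root of
   the latter, a polynomial that does not vanish there; so [X - x0] divides the
   numerator. *)
Lemma regular_poly (f : L) :
  (forall x0 y0, x0 ^+ n + y0 ^+ n + 1 = 0 -> locally_regular x0 y0 f) ->
  exists2 N : {poly {poly K}}, (size N <= n)%N & f = ev N.
Proof.
move=> reg; have n_gt0 := exponent_gt0 n_neq0.
(* A denominator at a single point has a nonzero multiple in [K[x]], by [ev_norm]. *)
have [B [A [B0 sA BA]]] : exists (B : {poly K}) (A : {poly {poly K}}),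
    [/\ B != 0, (size A <= n)%N & f * evx B = ev A].
  have [y1 P0] := fermat_affine_point n_neq0.
  have [G [H [H0 E]]] := reg _ _ P0; have evH0 := ev_neq0 P0 H0.
  have [B B0 [H' HB]] := ev_norm n_neq0 fermat_xy evH0.
  have [A sA AE] := ev_reduce iota n_neq0 fermat_xy (G * H').
  exists B, A; split=> //.
  by rewrite -HB -AE !rmorphM /= mulrA E.
elim: {B}(size B) {-2}B (leqnn (size B)) A B0 sA BA => [|k IH] B sB A B0 sA BA.
  by move: B0; rewrite -size_poly_leq0 sB.
have [/eqP/size_poly1P [b b0 BE]|/closed_rootP [x0 rx0]] := eqVneq (size B) 1%N.
  exists (b^-1%:P%:P * A).
    by rewrite mul_polyC (leq_trans (size_scale_leq _ _)).
  rewrite rmorphM /= -BA evC evxC BE evxC mulrCA -rmorphM mulVf //.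
  by rewrite rmorph1 mulr1.
have /factor_theorem [B1 BE] := rx0.
have B10 : B1 != 0 by apply: contraNneq B0 => B10; rewrite BE B10 mul0r.
suff Aroot i : root A`_i x0.
  pose A' := \poly_(i < n) (A`_i %/ ('X - x0%:P)).
  have AE : A = ('X - x0%:P)%:P * A'.
    apply/polyP => i; rewrite coefCM coef_poly; case: ltnP => ni.
      by rewrite mulrC divpK // dvdp_XsubCl.
    by rewrite nth_default ?mulr0 // (leq_trans sA).
  apply: (IH B1 _ A') => //; last 2 first.
  - exact: size_poly.
  - have pi0 : evx ('X - x0%:P) != 0.
      by rewrite -(rmorph0 evx) (inj_eq (evx_inj x_transc)) polyXsubC_eq0.
    apply: (mulfI pi0); rewrite mulrCA [evx _ * evx _]mulrC -rmorphM -BE BA.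
    by rewrite {1}AE rmorphM /= evC.
  move: sB; rewrite BE size_Mmonic ?monicXsubC // size_XsubC addn2 /=.
  by rewrite ltnS.
pose bar : {poly {poly K}} -> {poly K} := map_poly (ev0x x0).
suff q0 : bar A = 0.
  have := congr1 (fun q : {poly K} => q`_i) q0.
  by rewrite coef_map coef0 /= evx_idfun => /rootP.
apply/eqP/negPn/negP => q0.
have sq : (size (bar A) <= n)%N by exact: leq_trans (size_poly _ _) sA.
pose M : {poly K} := 'X^n + (x0 ^+ n + 1)%:P.
have sM : size M = n.+1 by rewrite size_XnaddC.
have M0 : M != 0 by rewrite -size_poly_eq0 sM.
have barM : bar (fermat_poly K n) = M.
  rewrite /bar rmorphD /= map_polyXn map_polyC /= rmorphD rmorphXn rmorph1 /=.
  by rewrite evxX.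
have div_bar y0 : root M y0 -> exists2 H, bar A * H %% M = 0 & H.[y0] != 0.
  move=> /rootP ry0; have P0 : x0 ^+ n + y0 ^+ n + 1 = 0.
    by rewrite -ry0 hornerD hornerXn hornerC; ring.
  have [G [H [H0 E]]] := reg _ _ P0; exists (bar H) => //.
  have /(ev_kernel n_neq0 fermat_xy x_transc) [Q QE] : ev (A * H - B%:P * G) = 0.
    by rewrite evB !evM evC -BA -E; ring.
  have := congr1 bar QE; rewrite /bar rmorphB !rmorphM /= map_polyC /=.
  rewrite evx_idfun (rootP rx0) mul0r subr0 => ->.
  by rewrite /bar /= in barM; rewrite barM modp_mull.
(* As [d] has degree less than [n], [M / d] has a root [y0]. From [M | bar A * H] follows
   [M / d | H], against [H(y0) != 0]. Using [M / d] also covers multiple roots of [M]. *)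
pose d := gcdp M (bar A).
have dM : d %| M := dvdp_gcdl _ _.
have ME := divpK dM.
have d0 : d != 0 by rewrite gcdp_eq0 negb_and M0.
have e0 : M %/ d != 0 by rewrite dvdp_div_eq0.
have /closed_rootP [y0 ry0] : size (M %/ d) != 1%N.
  rewrite size_divp // sM; have : (size d <= n)%N.
    exact: leq_trans (dvdp_leq q0 (dvdp_gcdr _ _)) sq.
  by move=> sd; apply/eqP; lia.
have [|H /eqP MH] := div_bar y0; first by rewrite -ME rootM ry0.
move: MH; rewrite -/(_ %| _) -{1}ME -(divpK (dvdp_gcdr M (bar A))) -/d.
rewrite mulrAC dvdp_mul2r // Gauss_dvdpr ?coprimep_div_gcd ?M0 //.
by rewrite -dvdp_XsubCl in ry0 => /(dvdp_trans ry0); rewrite dvdp_XsubCl => /rootP ->; rewrite eqxx.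
Qed.

End FermatRegular.

(** * Holomorphic forms *)

Definition reversal (K : nzRingType) (m : nat) (q : {poly K}) : {poly K} :=
  \poly_(i < m) q`_(m - i.+1).

Lemma evx_reversal (K L : fieldType) (iota : {rmorphism K -> L}) (x : L) m (q : {poly K}) :
  x != 0 -> (size q <= m.+1)%N ->
  evx iota x (reversal m.+1 q) = evx iota x^-1 q * x ^+ m.
Proof.
move=> x0 sq; rewrite /evx !(@horner_coef_wide _ m.+1); last 2 first.
- exact: leq_trans (size_poly _ _) sq.
- exact: leq_trans (size_poly _ _) (size_poly _ _).
rewrite mulr_suml (reindex_inj rev_ord_inj) /=; apply: eq_bigr => i _.
rewrite !coef_map coef_poly subSS.
have im : (i <= m)%N by rewrite -ltnS.
rewrite ltnS leq_subr subSS subKn // -mulrA exprVn; congr (_ * _).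
have -> : x ^+ m = x ^+ i * x ^+ (m - i) by rewrite -exprD subnKC.
by rewrite mulKf // expf_neq0.
Qed.

Section FermatCurve.

Variables (K : closedFieldType) (n : nat) (X : fermat_curve K n).
Hypothesis n_neq0 : n%:R != 0 :> K.

Local Notation L := (function_field X).
Local Notation iota := (const X).
Local Notation x := (coord_x X).
Local Notation y := (coord_y X).
Local Notation u := (x^-1).
Local Notation v := (y / x).

Let xy := fermat_eq X.
Let x_transc := @coord_x_transcendental _ _ X.

Lemma fermat_x_neq0 : x != 0. Proof. exact: x_neq0 x_transc. Qed.

Lemma fermat_y_neq0 : y != 0. Proof. exact: y_neq0 n_neq0 xy x_transc. Qed.

Lemma fermat_fracP (f : L) : exists G H, ev iota x y H != 0 /\ f = ev iota x y G / ev iota x y H.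
Proof. by apply: ev_fracP; exact: function_field_gen. Qed.

Lemma fermat_uv : u ^+ n + v ^+ n + 1 = 0.
Proof.
have x0 := expf_neq0 n fermat_x_neq0.
apply: (mulfI x0); rewrite mulr0 -[RHS]xy expr_div_n exprVn; field.
exact: x0.
Qed.

Lemma u_transc (q : {poly K}) : (map_poly iota q).[u] = 0 -> q = 0.
Proof.
move=> q0; apply/eqP/negPn/negP => qn0.
have [m sq] : exists m, size q = m.+1.
  by exists (size q).-1; rewrite prednK // lt0n size_poly_eq0.
have : evx iota x (reversal m.+1 q) = 0.
  by rewrite evx_reversal ?fermat_x_neq0 ?sq // /evx q0 mul0r.
move/x_transc/(congr1 (fun r : {poly K} => r`_0)).
rewrite coef0 coef_poly /= subn1 /= => /eqP.
by have := qn0; rewrite -lead_coef_eq0 /lead_coef sq /= => /negPf ->.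
Qed.

Definition affine_part (G : {mpoly K[3]}) : {poly {poly K}} :=
  mmap (polyC \o polyC) (tnth [tuple 'X%:P; 'X; 1]) G.

(** The chart [X = 1], with [Z/X = u] as inner and [Y/X = v] as outer variable. It contains every
    point at infinity, since [X = Z = 0] forces [Y = 0] on the curve. *)
Definition infinite_part (G : {mpoly K[3]}) : {poly {poly K}} :=
  mmap (polyC \o polyC) (tnth [tuple 1; 'X; 'X%:P]) G.

Lemma ev_affine_part (F : fieldType) (f : {rmorphism K -> F}) (a b : F) G :
  ev f a b (affine_part G) = mmap f (tnth [tuple a; b; 1]) G.
Proof.
apply: (@rmorph_mmap 3 K {poly {poly K}} F (ev f a b) (polyC \o polyC)) => [c|].
  by rewrite /= evC evxC.
by case=> [[|[|[|?]]] i3] //; rewrite /tnth /= ?evC ?evxX ?evX ?rmorph1.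
Qed.

Lemma ev_infinite_part (F : fieldType) (f : {rmorphism K -> F}) (a b : F) G :
  ev f a b (infinite_part G) = mmap f (tnth [tuple 1; b; a]) G.
Proof.
apply: (@rmorph_mmap 3 K {poly {poly K}} F (ev f a b) (polyC \o polyC)) => [c|].
  by rewrite /= evC evxC.
by case=> [[|[|[|?]]] i3] //; rewrite /tnth /= ?evC ?evxX ?evX ?rmorph1.
Qed.

Lemma eq_mmap (k : nat) (R F : nzRingType) (f : R -> F) (h1 h2 : 'I_k -> F) :
  h1 =1 h2 -> mmap f h1 =1 mmap f h2.
Proof.
by move=> h12 G; apply: eq_bigr => m _; congr (_ * _); exact: mmap1_eq.
Qed.

Lemma regular_at_affine (x0 y0 : K) (f : L) :
  x0 ^+ n + y0 ^+ n + 1 = 0 -> regular_at (tnth [tuple x0; y0; 1]) f ->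
  locally_regular iota x y x0 y0 f.
Proof.
move=> P0 [d [G [H [_ _ HP ->]]]]; exists (affine_part G), (affine_part H).
have HP' : ev (idfun : {rmorphism K -> K}) x0 y0 (affine_part H) != 0.
  by rewrite ev_affine_part.
split=> //; have := ev_neq0 n_neq0 xy x_transc P0 HP'.
by rewrite !ev_affine_part => H0; rewrite divfK.
Qed.

Lemma regular_at_infinite (u0 v0 : K) (f : L) :
  u0 ^+ n + v0 ^+ n + 1 = 0 -> regular_at (tnth [tuple 1; v0; u0]) f ->
  locally_regular iota u v u0 v0 f.
Proof.
move=> P0 [d [G [H [hG hH HP ->]]]]; exists (infinite_part G), (infinite_part H).
have HP' : ev (idfun : {rmorphism K -> K}) u0 v0 (infinite_part H) != 0.
  by rewrite ev_infinite_part.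
split=> //; have := ev_neq0 n_neq0 fermat_uv u_transc P0 HP'.
have x0 := fermat_x_neq0.
have scale A : A \is d.-homog ->
    at_generic X A = x ^+ d * ev iota u v (infinite_part A).
  move=> hA; rewrite ev_infinite_part -mmap_dhomog //.
  apply: eq_mmap; case=> [[|[|[|?]]] i3] //; rewrite /tnth /=.
  - by rewrite mulr1.
  - by rewrite mulrC divfK.
  - by rewrite divff.
rewrite !scale // => H0; rewrite -mulf_div divff ?expf_neq0 // mul1r.
by rewrite divfK.
Qed.

Lemma fermat_pointP (P : 'I_3 -> K) : fermat_point n P <->
  (exists i, P i != 0) /\
  P ord0 ^+ n + P (lift ord0 ord0) ^+ n + P (lift ord0 (lift ord0 ord0)) ^+ n = 0.
Proof.
rewrite /fermat_point /fermat_form rmorph_sum !big_ord_recl big_ord0 /=.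
by rewrite !rmorphXn /= !mevalXU addr0 addrA.
Qed.

Lemma affine_fermat_point (x0 y0 : K) :
  x0 ^+ n + y0 ^+ n + 1 = 0 -> fermat_point n (tnth [tuple x0; y0; 1]).
Proof.
move=> P0; apply/fermat_pointP; split; first by exists ord_max; rewrite oner_neq0.
by rewrite /tnth /= expr1n.
Qed.

Lemma infinite_fermat_point (u0 v0 : K) :
  u0 ^+ n + v0 ^+ n + 1 = 0 -> fermat_point n (tnth [tuple 1; v0; u0]).
Proof.
move=> P0; apply/fermat_pointP; split; first by exists ord0; rewrite oner_neq0.
by rewrite /tnth /= expr1n -P0; ring.
Qed.

(** An arbitrary element of [form iota] need not be homogeneous in the derivation; a sum of terms
    [f dg] is. *)
Lemma differential_over_scale (S : L -> Prop) (w : form iota)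
    (D D' : derivation iota) c :
  differential_over S w -> (forall f, D' f = c * D f) -> w D' = c * w D.
Proof.
move=> [m [f [g [_ ->]]]] E; rewrite !form_sumE mulr_sumr.
by apply: eq_bigr => i _; rewrite !form_scaleE /diff E mulrCA.
Qed.

Variable D : derivation iota.
Hypothesis Dx : D x = 1.

(** Since [du = - dx / x^2], this is differentiation with respect to [u]. *)
Lemma infinite_derivation :
  exists D' : derivation iota, forall f, D' f = - x ^+ 2 * D f.
Proof.
have D'D f g : - x ^+ 2 * D (f + g) = - x ^+ 2 * D f + - x ^+ 2 * D g.
  by rewrite derivation_add mulrDr.
have D'M f g : - x ^+ 2 * D (f * g) = f * (- x ^+ 2 * D g) + g * (- x ^+ 2 * D f).
  by rewrite derivation_mul; ring.
have D'C c : - x ^+ 2 * D (iota c) = 0 by rewrite derivation_const mulr0.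
by exists (Derivation D'D D'M D'C).
Qed.

(** As [dx = - du / u^2] and [y = v / u], the form [x^a y^b dx / y^(n-1)] equals
    [- u^(n-3-a-b) v^b du / v^(n-1)], so regularity at infinity forces [a + b <= n - 3]. The bound
    has [+ 2] because a size is a degree plus one. *)
Lemma holomorphic_coef (w : form iota) : holomorphic w ->
  exists N : {poly {poly K}},
    (forall b, N`_b != 0 -> (size (N`_b)%R + b + 2 <= n)%N) /\
    w D * y ^+ n.-1 = ev iota x y N.
Proof.
move=> hol; have x0 := fermat_x_neq0; have y0 := fermat_y_neq0.
have n_gt0 := exponent_gt0 n_neq0.
have [N sN wN] : exists2 N : {poly {poly K}}, (size N <= n)%N &
    w D * y ^+ n.-1 = ev iota x y N.
  apply: (regular_poly n_neq0 xy x_transc) => a b P0.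
  apply: (differential_locally_regular n_neq0 xy x_transc P0 Dx).
    by move=> f; exact: regular_at_affine.
  exact/hol/affine_fermat_point.
have [D' D'E] := infinite_derivation.
have D'u : D' u = 1.
  by rewrite D'E (der_div (g := 1) D x0) ?mulVf // der1 Dx; field.
have wD' : w D' = - x ^+ 2 * w D.
  have [b P0] := fermat_affine_point n_neq0.
  exact: differential_over_scale (hol _ (affine_fermat_point P0)) D'E.
have [N' sN' wN'] : exists2 N' : {poly {poly K}}, (size N' <= n)%N &
    w D' * v ^+ n.-1 = ev iota u v N'.
  apply: (regular_poly n_neq0 fermat_uv u_transc) => a b P0.
  apply: (differential_locally_regular n_neq0 fermat_uv u_transc P0 D'u).
    by move=> f; exact: regular_at_infinite.
  exact/hol/infinite_fermat_point.
exists N; split=> // b Nb.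
have bn : (b < n)%N.
  by rewrite ltnNge; apply: contraNN Nb => nb; rewrite nth_default // (leq_trans sN).
pose m := (\max_(i < n) size (N'`_i)%R)%N.
have sm (i : 'I_n) : (size (N'`_i)%R <= m.+1)%N.
  by rewrite leqW // (leq_bigmax (F := fun i : 'I_n => size (N'`_i))).
(* The identity [y^(n-1) w(D) = - x^(n-3) v^(n-1) w(D')] multiplied by [x^(m + 2n)]: the factor
   [x^m] reverses the coefficients of [N'], and [x^(2n)] keeps the truncated subtractions exact. *)
pose T := ('X^(m + n.*2))%:P * N +
  \poly_(i < n) (reversal m.+1 N'`_i * 'X^(n.*2 + n.-1 - i - 2)).
have T0 : T = 0.
  apply: (ev_inj_size n_neq0 xy x_transc).
    rewrite (leq_trans (size_polyD _ _)) // geq_max size_poly andbT.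
    by rewrite mul_polyC (leq_trans (size_scale_leq _ _)).
  rewrite rmorphD /= evM evCX -wN.
  rewrite (ev_coef _ _ _ (size_poly _ _)).
  have -> : w D * y ^+ n.-1 = - x ^+ n.-1 / x ^+ 2 * (w D' * v ^+ n.-1).
    by rewrite wD' expr_div_n; field; rewrite x0 expf_neq0.
  rewrite wN' (ev_coef _ _ _ sN') !mulr_sumr -big_split /= big1 // => i _.
  rewrite coef_poly ltn_ord rmorphM rmorphXn /= evxX evx_reversal //.
  have xE : x ^+ (n.*2 + n.-1 - i - 2) * x ^+ i * x ^+ 2 = x ^+ (n.*2 + n.-1).
    by rewrite -!exprD; congr (_ ^+ _); have := ltn_ord i; lia.
  rewrite expr_div_n.
  rewrite -(mulfK (expf_neq0 2 x0) (x ^+ (_ - 2))).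
  rewrite -(mulfK (expf_neq0 i x0) (x ^+ (_ - 2) * _)).
  rewrite [_ * x ^+ 2 * _]mulrAC xE -addnn !exprD.
  field; by rewrite x0 expf_neq0.
have := congr1 (fun q : {poly {poly K}} => q`_b) T0.
rewrite coef0 coefD coefCM coef_poly bn => /eqP; rewrite addr_eq0 => /eqP E.
have := congr1 (fun q : {poly K} => size q) E.
rewrite size_polyN [size ('X^_ * _)]size_monicM ?monicXn // size_polyXn => sE.
have sR := size_poly m.+1 (fun i => (N'`_b)`_(m.+1 - i.+1)).
have := size_polyMleq (reversal m.+1 N'`_b) 'X^(n.*2 + n.-1 - b - 2).
rewrite -sE size_polyXn; move: sR; rewrite -/(reversal _ _) => sR.
move: Nb sR bn n_gt0; rewrite -size_poly_gt0.
move: (size N`_b) (size (reversal _ _)) => N_b r; lia.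
Qed.

End FermatCurve.

(** * Holomorphy of the monomial forms *)

Section HolomorphicMonomials.

Variables (K : closedFieldType) (n : nat) (X : fermat_curve K n).
Hypothesis n_neq0 : n%:R != 0 :> K.

Local Notation L := (function_field X).
Local Notation iota := (const X).
Local Notation x := (coord_x X).
Local Notation y := (coord_y X).

Lemma regular_at_monomial (P : 'I_3 -> K) (a b a' b' c c' : nat) :
  (a + b + c = a' + b' + c')%N ->
  P ord0 ^+ a' * P (lift ord0 ord0) ^+ b' * P (lift ord0 (lift ord0 ord0)) ^+ c' != 0 ->
  regular_at P (x ^+ a * y ^+ b / (x ^+ a' * y ^+ b')).
Proof.
pose mon a b c : {mpoly K[3]} :=
  'X_ord0 ^+ a * 'X_(lift ord0 ord0) ^+ b * 'X_(lift ord0 (lift ord0 ord0)) ^+ c.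
have mon_homog i j k : mon i j k \is (i + j + k).-homog.
  have hX l m : ('X_l ^+ m : {mpoly K[3]}) \is m.-homog.
    by rewrite -{2}[m]mul1n; apply: dhomogMn; rewrite dhomogX /= mdeg1.
  by apply: dhomogM; first apply: dhomogM; exact: hX.
have mon_gen i j k : at_generic X (mon i j k) = x ^+ i * y ^+ j.
  rewrite /at_generic !rmorphM !rmorphXn /= !mmapX !mmap1U /tnth /=.
  by rewrite expr1n mulr1.
move=> deg Pn0; exists (a + b + c)%N, (mon a b c), (mon a' b' c'); split.
- exact: mon_homog.
- by rewrite deg; exact: mon_homog.
- by rewrite !rmorphM !rmorphXn /= !mevalXU.
- by rewrite !mon_gen.
Qed.

Lemma regular_at_scale (P : 'I_3 -> K) (c : K) (f : L) :
  regular_at P f -> regular_at P (iota c * f).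
Proof.
move=> [d [G [H [hG hH HP ->]]]]; exists d, (c *: G), H; split=> //.
  exact: dhomogZ.
by rewrite /at_generic mmapZ mulrA.
Qed.

Definition monomial_form (i j : nat) : form iota :=
  (x ^+ i * y ^+ j / y ^+ n.-1) *: diff iota x.

(* [t] is [x], [y] or [1/x], depending on the chart that contains [P]. *)
Lemma monomial_form_local (P : 'I_3 -> K) : fermat_point n P ->
  exists2 t, regular_at P t & forall i j, (i + j + 3 <= n)%N ->
    exists2 g, regular_at P g & monomial_form i j = g *: diff iota t.
Proof.
have x0 : x != 0 := fermat_x_neq0 X; have y0 := fermat_y_neq0 X n_neq0.
have n_gt0 := exponent_gt0 n_neq0.
move=> /fermat_pointP [[k Pk]].
set P0 := P ord0; set P1 := P _; set P2 := P _ => PE.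
have [P2z|P2n] := eqVneq P2 0.
  have PE' : P0 ^+ n + P1 ^+ n = 0 by rewrite -PE P2z expr0n eqn0Ngt n_gt0 addr0.
  have Pz : (P0 == 0) = (P1 == 0).
    apply/eqP/eqP => z; move/eqP: PE'; rewrite z expr0n eqn0Ngt n_gt0 ?add0r ?addr0.
      by rewrite expf_eq0 => /andP[_ /eqP].
    by rewrite expf_eq0 => /andP[_ /eqP].
  have P0n : P0 != 0.
    apply: contraNneq Pk => z; have /eqP z1 : P1 == 0 by rewrite -Pz z eqxx.
    apply/eqP; move: k => [[|[|[|?]]] k3] //.
    - by rewrite -[RHS]z; congr (P _); exact: val_inj.
    - by rewrite -[RHS]z1; congr (P _); exact: val_inj.
    - by rewrite -[RHS]P2z; congr (P _); exact: val_inj.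
  have P1n : P1 != 0 by rewrite -Pz.
  exists x^-1.
    have := @regular_at_monomial P 0 0 1 0 1 0 erefl.
    by rewrite !expr0 expr1 !mulr1 !mul1r; apply.
  (* Here [dx = - x^2 d(1/x)], and homogenising leaves [Z] to the power [n - 3 - i - j], nonnegative
     by the degree bound. *)
  move=> i j ij; exists (iota (-1) * (x ^+ i.+2 * y ^+ 0 / (x ^+ 0 * y ^+ (n.-1 - j)))).
    apply/regular_at_scale/(@regular_at_monomial _ _ _ _ _ (n.-1 - j - i.+2) 0).
      by lia.
    by rewrite !expr0 mul1r mulr1 expf_neq0.
  apply: form_eqP => D; rewrite /monomial_form !form_scaleE /diff.
  rewrite (der_div (f := x^-1) (g := 1) D x0) ?mulVf //. rewrite der1 rmorphN rmorph1.
  have -> : n.-1 = (n.-1 - j + j)%N by lia.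
  rewrite addnK exprD expr0 !exprS. by field; rewrite x0 !expf_neq0.
have [P1z|P1n] := eqVneq P1 0; last first.
  exists x.
    have := @regular_at_monomial P 1 0 0 0 0 1.
    by rewrite !expr0 expr1 !mulr1 !mul1r divr1; apply.
  move=> i j ij; exists (x ^+ i * y ^+ j / (x ^+ 0 * y ^+ n.-1)).
    apply/(@regular_at_monomial _ _ _ _ _ (n.-1 - i - j) 0); first by lia.
    by rewrite !expr0 mul1r mulr1 expf_neq0.
  by rewrite expr0 mul1r.
have P0n : P0 != 0.
  apply: contraNneq P2n => z; move/eqP: PE.
  by rewrite z P1z !expr0n eqn0Ngt n_gt0 !add0r expf_eq0 => /andP[_].
exists y.
  have := @regular_at_monomial P 0 1 0 0 0 1.
  by rewrite !expr0 expr1 !mulr1 !mul1r divr1; apply.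
(* On the curve [dx / y^(n-1) = - dy / x^(n-1)], and [X] does not vanish at [P]. *)
move=> i j ij; exists (iota (-1) * (x ^+ i * y ^+ j / (x ^+ n.-1 * y ^+ 0))).
  apply/regular_at_scale/(@regular_at_monomial _ _ _ _ _ (n.-1 - i - j) 0).
    by lia.
  by rewrite !expr0 !mulr1 expf_neq0.
apply: form_eqP => D; rewrite /monomial_form !form_scaleE /diff.
rewrite (der_yE n_neq0 (fermat_eq X) (@coord_x_transcendental _ _ X)).
rewrite rmorphN rmorph1 expr0 mulr1 expr_div_n.
by field; rewrite !expf_neq0.
Qed.

Lemma monomial_form_holomorphic (m : nat) (i j : 'I_m -> nat) (c : 'I_m -> K) :
  (forall k, i k + j k + 3 <= n)%N ->
  holomorphic (\sum_(k < m) iota (c k) *: monomial_form (i k) (j k)).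
Proof.
move=> ij P /monomial_form_local [t regt loc].
have /boolp.choice [g gP] : forall k : 'I_m, exists g,
    regular_at P g /\ monomial_form (i k) (j k) = g *: diff iota t.
  by move=> k; have [g reg E] := loc _ _ (ij k); exists g.
exists m, (fun k => iota (c k) * g k), (fun=> t); split=> [k|].
  by split=> //; apply: regular_at_scale; have [] := gP k.
by apply: eq_bigr => k _; have [_ ->] := gP k; rewrite scalerA.
Qed.

End HolomorphicMonomials.

(** * The Cartier operator *)

Section FrobeniusExpansion.

Variables (K L : fieldType) (iota : {rmorphism K -> L}) (p : nat) (x : L).
Hypothesis charL : p \in [pchar L].

Local Notation frob := (pFrobenius_aut charL).

(* [Q] is mapped to [sum_i (Q_i)^p x^i]. *)
Local Notation phi := (evx frob x).

Let p_gt0 : (0 < p)%N.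
Proof. exact: prime_gt0 (pcharf_prime charL). Qed.

Lemma frob_evxE m (Q : {poly L}) : (size Q <= m)%N ->
  phi Q = \sum_(i < m) Q`_i ^+ p * x ^+ i.
Proof.
move=> sQ; rewrite /evx (@horner_coef_wide _ m).
  by apply: eq_bigr => i _; rewrite coef_map /= pFrobenius_autE.
exact: leq_trans (size_poly _ _) sQ.
Qed.

(** [phi] takes the same value at [X^p] and at the constant [x], so coefficients from degree [p] on
    fold back with a factor [x]; only degree [2p - 1] could land in degree [p - 1]. *)
Lemma frob_evx_reduce (Q : {poly L}) : Q`_(p + p.-1) = 0 ->
  (size Q <= p + p)%N ->
  exists2 R : {poly L}, (size R <= p)%N & phi R = phi Q /\ R`_p.-1 = Q`_p.-1.
Proof.
move=> Q0 sQ; exists (take_poly p Q + x *: drop_poly p Q).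
  rewrite (leq_trans (size_polyD _ _)) // geq_max size_take_poly /=.
  by rewrite (leq_trans (size_scale_leq _ _)) // size_drop_poly leq_subLR.
split; last first.
  rewrite coefD coefZ coef_take_poly coef_drop_poly ltn_predL p_gt0 [(_.-1 + _)%N]addnC.
  by rewrite Q0 mulr0 addr0.
rewrite -[in RHS](poly_take_drop p Q) !rmorphD -mul_polyC !rmorphM rmorphXn /=.
by rewrite evxC evxX /= pFrobenius_autE mulrC.
Qed.

Lemma frob_evx_size (Q : {poly L}) :
  exists2 R : {poly L}, (size R <= p)%N & phi R = phi Q.
Proof.
pose M : {poly L} := 'X^p - x%:P.
have mM : M \is monic by exact: monicXnsubC.
exists (Pdiv.Ring.rmodp Q M).
  by rewrite -ltnS -(size_XnsubC x p_gt0) Pdiv.Ring.ltn_rmodp monic_neq0.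
rewrite [in RHS](Pdiv.RingMonic.rdivp_eq mM Q) rmorphD rmorphM /= rmorphB rmorphXn /=.
by rewrite evxX evxC /= pFrobenius_autE subrr mulr0 add0r.
Qed.

Variable D : derivation iota.
Hypothesis Dx : D x = 1.

(** [D] kills p-th powers, so it is also a derivation over [L] embedded in itself by Frobenius, and
    [der_evx] applies to [phi]. *)
Lemma frob_derivation (charK : p \in [pchar K]) :
  exists D' : derivation frob, der_fun D' = D.
Proof.
have DC c : D (frob c) = 0 by rewrite /= pFrobenius_autE der_pchar.
by exists (Derivation (derivation_add D) (derivation_mul D) DC).
Qed.

Lemma der_frob_evx (charK : p \in [pchar K]) Q : D (phi Q) = phi Q^`().
Proof.
have [D' D'E] := frob_derivation charK.
by rewrite -D'E der_evx D'E Dx mulr1.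
Qed.

Lemma deriv_eq0_small (Q : {poly L}) : (size Q <= p)%N -> Q^`() = 0 -> Q = (Q`_0)%:P.
Proof.
move=> sQ Q'0; apply/polyP => -[|i]; rewrite coefC //=.
have [pi|ip] := leqP p i.+1; first by rewrite nth_default // (leq_trans sQ).
have := congr1 (fun q : {poly L} => q`_i) Q'0.
rewrite coef_deriv coef0 -mulr_natr => /eqP; rewrite mulf_eq0.
rewrite -(dvdn_pcharf charL) gtnNdvd // orbF => /eqP //.
Qed.

(** Differentiating a relation lowers its degree, and below degree [p] only constants have
    derivative zero. *)
Lemma frob_evx_inj (charK : p \in [pchar K]) (Q : {poly L}) :
  (size Q <= p)%N -> phi Q = 0 -> Q = 0.
Proof.
elim: {Q}(size Q) {-2}Q (leqnn (size Q)) => [|k IH] Q sQk sQ Q0.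
  by apply/eqP; rewrite -size_poly_leq0.
have [//|Qn0] := eqVneq Q 0.
have Q'0 : Q^`() = 0.
  apply: IH; last by rewrite -der_frob_evx // Q0 der0.
    by rewrite -ltnS; apply: leq_trans (lt_size_deriv Qn0) sQk.
  exact: leq_trans (leq_trans (size_poly _ _) (leq_pred _)) sQ.
have QE := deriv_eq0_small sQ Q'0.
move: Q0; rewrite QE evxC /= pFrobenius_autE => /eqP.
by rewrite expf_eq0 => /andP[_ /eqP ->].
Qed.

End FrobeniusExpansion.

Lemma sum_ord_pred (V : nmodType) (m : nat) (F : nat -> V) :
  (0 < m)%N -> \sum_(i < m) F i = \sum_(i < m.-1) F i + F m.-1.
Proof. by case: m => // m _; rewrite big_ord_recr. Qed.

(** * Expansion over p-th powers and the Cartier kernel *)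

Section CartierKernel.

Variables (K : closedFieldType) (p s : nat).
Hypothesis char_p : p \in [pchar K].
Variable X : fermat_curve K (s * p + 1).

Local Notation n := (s * p + 1)%N.
Local Notation L := (function_field X).
Local Notation iota := (const X).
Local Notation x := (coord_x X).
Local Notation y := (coord_y X).

Lemma fermat_degree_neq0 : n%:R != 0 :> K.
Proof. by rewrite natrD natrM (pcharf0 char_p) mulr0 add0r oner_neq0. Qed.

Lemma pchar_function_field : p \in [pchar L].
Proof. exact: (rmorph_pchar iota char_p). Qed.

Let n_neq0 := fermat_degree_neq0.
Let charL := pchar_function_field.
Let x0 : x != 0 := fermat_x_neq0 X.
Let y0 : y != 0 := fermat_y_neq0 X n_neq0.

Let p_gt0 : (0 < p)%N.
Proof. exact: prime_gt0 (pcharf_prime char_p). Qed.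

Local Notation frob := (pFrobenius_aut charL).
Local Notation phi := (evx frob x).

Lemma const_root (c : K) : exists d, d ^+ p = c.
Proof.
have /closed_rootP [d /rootP rd] : size ('X^p - c%:P) != 1%N.
  by rewrite size_XnsubC // eqSS -lt0n.
exists d; move: rd; rewrite hornerD hornerN hornerXn hornerC => /eqP.
by rewrite subr_eq0 => /eqP.
Qed.

(* Since [y * y^(s p) = - 1 - x * x^(s p)], [y] is affine in [x] over the field
   of [p]-th powers. *)
Definition frob_y : {poly L} := (- (y ^- s))%:P - (x ^+ s / y ^+ s) *: 'X.

Lemma frob_yE : phi frob_y = y.
Proof.
have yn0 : (y ^+ (s * p)) != 0 by rewrite expf_neq0.
rewrite /frob_y -mul_polyC rmorphB rmorphM /= !evxC evxX /= rmorphN /= !pFrobenius_autE.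
rewrite expr_div_n exprVn -!exprM.
have := fermat_eq X; rewrite !exprD !expr1 => E.
apply: (mulIf yn0); apply/eqP; rewrite -subr_eq0 -oppr_eq0 -E; apply/eqP.
by field.
Qed.

(** The values of [phi] form a ring containing [x], [y] and the constants, which are p-th powers in
    [K]. It is closed under inverses because [1/h = h^(p-1) (1/h)^p]. *)
Lemma frob_evx_surj (f : L) : exists2 Q : {poly L}, (size Q <= p)%N & f = phi Q.
Proof.
suff [Q ->] : exists Q, f = phi Q.
  by have [R sR RE] := frob_evx_size x charL Q; exists R.
have evx_phi (q : {poly K}) : exists Q, evx iota x q = phi Q.
  elim/poly_ind: q => [|q c [Q QE]]; first by exists 0; rewrite !rmorph0.
  have [d dE] := const_root c; exists (Q * 'X + (iota d)%:P).
  by rewrite !rmorphD !rmorphM /= !evxX !evxC /= pFrobenius_autE QE -rmorphXn dE.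
have ev_phi G : exists Q, ev iota x y G = phi Q.
  elim/poly_ind: G => [|G q [Q QE]]; first by exists 0; rewrite !rmorph0.
  have [R RE] := evx_phi q; exists (Q * frob_y + R).
  by rewrite !rmorphD !rmorphM /= evX evC frob_yE QE RE.
have [G [H [H0 ->]]] := fermat_fracP f.
have [[Q QE] [R RE]] := (ev_phi G, ev_phi H).
exists (Q * R ^+ p.-1 * (ev iota x y H)^-1%:P).
rewrite !rmorphM rmorphXn /= evxC /= pFrobenius_autE -RE -QE -mulrA; congr (_ * _).
rewrite exprVn.
have -> : ev iota x y H ^- p = (ev iota x y H * ev iota x y H ^+ p.-1)^-1.
  by rewrite -exprS prednK.
by field; rewrite expf_neq0.
Qed.

Variable D : derivation iota.
Hypothesis Dx : D x = 1.

Lemma diff_pos (f : L) : D f = 0 -> exists z, f = z ^+ p.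
Proof.
have [Q sQ ->] := frob_evx_surj f; rewrite (der_frob_evx charL Dx char_p) => Q'0.
have sQ' : (size Q^`() <= p)%N.
  exact: leq_trans (leq_trans (size_poly _ _) (leq_pred _)) sQ.
have {}Q'0 := frob_evx_inj Dx char_p sQ' Q'0.
exists Q`_0; rewrite (deriv_eq0_small charL sQ Q'0) evxC /= pFrobenius_autE.
by rewrite coefC.
Qed.

(** An expansion in [z] without the term [z^(p-1)] can be integrated, so [w] is exact whatever [z]
    is; and the derivative of an expansion in [x] has no term [x^(p-1)]. The converse takes
    [z = x]. *)
Lemma cartier_coef (w : form iota) (Q : {poly L}) :
  (forall D', w D' = D' x * w D) -> w D = phi Q -> (size Q <= p + p.-1)%N ->
  cartier p w 0 <-> Q`_p.-1 = 0.
Proof.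
move=> wD wQ sQ.
have Q0 : Q`_(p + p.-1) = 0 by rewrite nth_default.
have sQ2 : (size Q <= p + p)%N by rewrite (leq_trans sQ) // leq_add2l leq_pred.
have [R sR [RE Rp]] := frob_evx_reduce x charL Q0 sQ2.
rewrite -Rp; rewrite -{}RE in wQ; split=> [[z [u [sep wE /esym zero]]]|Rp0].
  have Dz : D z != 0 by apply/eqP => /diff_pos [t tE]; apply: sep; exists t.
  have up : u p.-1 = 0.
    have := congr1 (fun w : form iota => w D) zero; rewrite form_scaleE => /eqP.
    by rewrite mulf_eq0 /diff (negPf Dz) orbF => /eqP.
  (* The divisors [i + 1] are less than [p]; the missing term is the one that would require dividing
     by [p]. *)
  pose F := \sum_(i < p.-1) u i ^+ p * (z ^+ i.+1 / i.+1%:R).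
  have DF : D F = w D.
    rewrite wE form_scaleE /diff (sum_ord_pred (fun i => u i ^+ p * z ^+ i) p_gt0) up.
    rewrite expr0n eqn0Ngt p_gt0 mul0r addr0 mulr_suml der_sum.
    apply: eq_bigr => i _; rewrite derivation_mul der_pchar // mulr0 addr0 -mulrA.
    congr (_ * _); have iL : i.+1%:R != 0 :> L.
      rewrite -(dvdn_pcharf charL) gtnNdvd //.
      by rewrite -[X in (_ < X)%N](prednK p_gt0) ltnS.
    rewrite (der_div (h := i.+1%:R) (g := z ^+ i.+1) D iL) ?divfK //.
    have -> : D i.+1%:R = 0 by rewrite -(rmorph_nat iota) derivation_const.
    by rewrite derX; move: (i.+1%:R : L) iL => c iL; field.
  have [S sS SE] := frob_evx_surj F.
  have RS : R - S^`() = 0.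
    apply: (frob_evx_inj Dx char_p).
      rewrite (leq_trans (size_polyD _ _)) // geq_max sR size_polyN.
      exact: leq_trans (leq_trans (size_poly _ _) (leq_pred _)) sS.
    by rewrite rmorphB /= -wQ -(der_frob_evx charL Dx char_p) -SE DF subrr.
  have -> : R = S^`() by apply/eqP; rewrite -subr_eq0 RS.
  by rewrite coef_deriv prednK // nth_default // mul0rn.
exists x, (fun i => R`_i); split.
- move=> [z zE]; have := Dx; rewrite zE der_pchar // => /eqP.
  by rewrite eq_sym oner_eq0.
- by apply: form_eqP => D'; rewrite form_scaleE wD wQ (frob_evxE x charL sR) mulrC.
- by rewrite Rp0 scale0r.
Qed.

End CartierKernel.

(** * Monomial forms *)

Lemma sum_ord_mul (V : nmodType) (s p : nat) (F : nat -> V) :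
  \sum_(a < s * p) F a = \sum_(k : 'I_s * 'I_p) F (k.1 * p + k.2)%N.
Proof.
transitivity (\sum_(i < s) \sum_(j < p) F (i * p + j)%N); last by rewrite pair_bigA.
elim: s => [|s IH]; first by rewrite mul0n !big_ord0.
rewrite big_ord_recr /= -IH mulSnr big_split_ord.
by congr (_ + _).
Qed.

Lemma card_triangle (m k : nat) : (k <= m)%N ->
  (2 * #|[set a : 'I_m * 'I_m | a.1 + a.2 < k]| = k * k.+1)%N.
Proof.
move=> km; have cardE (i : 'I_m) :
    (\sum_(j < m) (i + j < k))%N = (k - i)%N.
  have kim : (k - i <= m)%N by rewrite (leq_trans (leq_subr _ _)).
  rewrite -(big_mkord xpredT (fun j => (i + j < k : nat))) (big_cat_nat (leq0n _) kim) //=.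
  rewrite [X in (_ + X)%N]big_nat_cond [X in (_ + X)%N]big1 => [|j /andP[/andP[kj _] _]].
    rewrite addn0 big_nat_cond (eq_bigr (fun=> 1%N)) => [|j /andP[/andP[_ jk] _]].
      by rewrite -big_nat_cond sum_nat_const_nat subn0 muln1.
    by rewrite (_ : (i + j < k)%N) //; lia.
  by rewrite ltnNge (_ : (k <= i + j)%N) //; lia.
rewrite -sum1dep_card big_mkcond -(pair_bigA _ (fun i j : 'I_m => if (i + j < k)%N then 1%N else 0%N)) /=.
rewrite (eq_bigr (fun i : 'I_m => (k - i)%N)) => [|i _]; last first.
  by rewrite -cardE; apply: eq_bigr => j _; case: ltnP.
rewrite -(big_mkord xpredT (fun i => (k - i)%N)) (big_cat_nat (leq0n _) km) //=.
rewrite [X in (_ + X)%N]big_nat_cond [X in (_ + X)%N]big1 => [|j /andP[/andP[kj _] _]]; last first.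
  by apply/eqP; rewrite subn_eq0.
rewrite addn0; elim: {km cardE} k => [|k IH]; first by rewrite big_geq.
rewrite big_nat_recl // subn0 (eq_bigr (fun i => (k - i)%N)) => [|i _].
  by rewrite mulnDr IH; lia.
by rewrite subSS.
Qed.

Section MonomialForms.

Variables (K : closedFieldType) (p s : nat).
Hypothesis char_p : p \in [pchar K].
Variable X : fermat_curve K (s * p + 1).

Local Notation n := (s * p + 1)%N.
Local Notation L := (function_field X).
Local Notation iota := (const X).
Local Notation x := (coord_x X).
Local Notation y := (coord_y X).

Let n_neq0 := fermat_degree_neq0 s char_p.
Let charL := pchar_function_field char_p X.
Let x0 : x != 0 := fermat_x_neq0 X.
Let y0 : y != 0 := fermat_y_neq0 X n_neq0.

Let p_gt0 : (0 < p)%N.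
Proof. exact: prime_gt0 (pcharf_prime char_p). Qed.

Let n1 : n.-1 = (s * p)%N.
Proof. by rewrite addn1. Qed.

Local Notation frob := (pFrobenius_aut charL).
Local Notation phi := (evx frob x).

(* Base [p] digits of the exponents: [((i1, j1), (i0, j0))] stands for
   [x^(i1 p + i0) y^(j1 p + j0)]. *)
Definition exponents := (('I_s * 'I_s) * ('I_p * 'I_p))%type.

Definition exp_x (t : exponents) : nat := (t.1.1 * p + t.2.1)%N.
Definition exp_y (t : exponents) : nat := (t.1.2 * p + t.2.2)%N.

(** The exponent maps are arbitrary because this is applied both to the monomials and to their
    images under the Cartier operator. *)
Lemma monomials_free (e1 e2 : exponents -> nat) (S : pred exponents) (c : exponents -> K) :
  {in S &, forall t t', e1 t = e1 t' -> e2 t = e2 t' -> t = t'} ->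
  (forall t, t \in S -> (e2 t < n)%N) ->
  \sum_(t in S) iota (c t) * (x ^+ e1 t * y ^+ e2 t) = 0 ->
  forall t, t \in S -> c t = 0.
Proof.
move=> inj e2n sum0 t St.
pose G : {poly {poly K}} := \sum_(t in S) (c t *: 'X^(e1 t))%:P * 'X^(e2 t).
have G0 : G = 0.
  apply: (ev_inj_size n_neq0 (fermat_eq X) (@coord_x_transcendental _ _ X)).
    rewrite (leq_trans (size_sum _ _ _)) //; apply/bigmax_leqP => r Sr.
    rewrite mul_polyC (leq_trans (size_scale_leq _ _)) // size_polyXn.
    exact: e2n.
  rewrite /G rmorph_sum -[RHS]sum0 /=; apply: eq_bigr => r _.
  by rewrite evM evC evXn -mul_polyC rmorphM rmorphXn /= evxC evxX mulrA.
have := congr1 (fun q : {poly {poly K}} => q`_(e2 t)`_(e1 t)) G0.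
rewrite !coef0 /G !coef_sum (bigD1 t) //= big1 => [|r /andP[Sr rt]].
  by rewrite coefCM coefXn eqxx mulr1 coefZ coefXn eqxx mulr1 addr0.
rewrite coefCM coefXn; case: eqP => [e2E|_]; last by rewrite mulr0 coef0.
rewrite mulr1 coefZ coefXn; case: eqP => [e1E|_]; last by rewrite mulr0.
by rewrite (inj r t) ?eqxx in rt.
Qed.

Variable D : derivation iota.
Hypothesis Dx : D x = 1.

Lemma monomial_form_der i j (D' : derivation iota) :
  monomial_form i j D' = D' x * (x ^+ i * y ^+ j / y ^+ (s * p)).
Proof. by rewrite /monomial_form form_scaleE /diff n1 mulrC. Qed.

Lemma holomorphic_monomials (w : form iota) : holomorphic w ->
  exists2 c : exponents -> K, forall t, c t != 0 -> (exp_x t + exp_y t + 3 <= n)%N &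
    w = \sum_t iota (c t) *: monomial_form (exp_x t) (exp_y t).
Proof.
move=> hol; have [N [sN wN]] := holomorphic_coef n_neq0 Dx hol.
exists (fun t => N`_(exp_y t)`_(exp_x t)) => [t ct|].
  have Nn0 : N`_(exp_y t) != 0 by apply: contraNneq ct => ->; rewrite coef0.
  have := sN _ Nn0; have : (exp_x t < size (N`_(exp_y t))%R)%N.
    by rewrite ltnNge; apply: contraNN ct => ?; rewrite nth_default.
  by lia.
have wD D' : w D' = D' x * w D.
  have [y1 P0] := fermat_affine_point n_neq0.
  apply: (differential_over_scale (hol _ (affine_fermat_point P0))).
  exact: (der_unique n_neq0 (fermat_eq X) (@coord_x_transcendental _ _ X) D' Dx
    (@fermat_fracP _ _ X)).
apply: form_eqP => D'; rewrite form_sumE wD.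
have -> : w D = ev iota x y N / y ^+ (s * p).
  by rewrite -wN n1 mulfK // expf_neq0.
(* The degree bound excludes the exponent [s p = n - 1], so the digits in ['I_s * 'I_p] index all
   exponents that occur. *)
have sNy : (size N <= s * p)%N.
  rewrite leqNgt; apply/negP => sN'.
  have [m sm] : exists m, size N = m.+1 by exists (size N).-1; lia.
  have := sN m; rewrite -[m]/(m.+1.-1) -sm -/(lead_coef N) lead_coef_eq0.
  rewrite -size_poly_eq0 sm => /(_ isT); lia.
rewrite (ev_coef _ _ _ sNy) mulrA mulr_sumr mulr_suml.
rewrite (sum_ord_mul _ _ (fun j => D' x * (evx iota x N`_j * y ^+ j) / y ^+ (s * p))).
transitivity (\sum_(k : 'I_s * 'I_p) \sum_(l : 'I_s * 'I_p)
    iota N`_(k.1 * p + k.2)`_(l.1 * p + l.2) *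
    (D' x * (x ^+ (l.1 * p + l.2) * y ^+ (k.1 * p + k.2) / y ^+ (s * p)))).
  apply: eq_bigr => k _; set j := (k.1 * p + k.2)%N.
  have sNj : (size (N`_j)%R <= s * p)%N.
    have [->|Nj] := eqVneq N`_j 0; first by rewrite size_poly0.
    by have := sN j Nj; lia.
  rewrite {1}/evx (@horner_coef_wide _ (s * p)); last first.
    exact: leq_trans (size_poly _ _) sNj.
  rewrite (sum_ord_mul _ _ (fun i => (map_poly iota N`_j)`_i * x ^+ i)).
  rewrite mulr_suml mulr_sumr mulr_suml; apply: eq_bigr => l _.
  by rewrite coef_map /=; set i := (l.1 * p + l.2)%N; ring.
rewrite pair_bigA /=.
rewrite (reindex (fun t : exponents => ((t.1.2, t.2.2), (t.1.1, t.2.1)))) /=; last first.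
  exists (fun r : ('I_s * 'I_p) * ('I_s * 'I_p) => ((r.2.1, r.1.1), (r.2.2, r.1.2))).
    by case=> [[? ?] [? ?]].
  by case=> [[? ?] [? ?]].
by apply: eq_bigr => t _; rewrite form_scaleE monomial_form_der.
Qed.

(** The high digits and [y^(s p) = (y^s)^p] go into the coefficient, which [phi] raises to the power
    [p]; the low digits become powers of [X] and of [frob_y]. *)
Definition frob_monomial (t : exponents) : {poly L} :=
  (x ^+ t.1.1 * y ^+ t.1.2 / y ^+ s)%:P * 'X^(t.2.1) * frob_y X ^+ t.2.2.

Lemma frob_monomialE t :
  phi (frob_monomial t) = x ^+ exp_x t * y ^+ exp_y t / y ^+ (s * p).
Proof.
rewrite /frob_monomial !rmorphM !rmorphXn /= !evxC evxX frob_yE /=.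
rewrite !pFrobenius_autE exprVn -!exprM /exp_x /exp_y !exprD.
rewrite [(t.1.1 * p)%N]mulnC [(t.1.2 * p)%N]mulnC.
by field; rewrite expf_neq0.
Qed.

Lemma size_frob_monomial t : (size (frob_monomial t) <= p + p.-1)%N.
Proof.
have sy : (size (frob_y X) <= 2)%N.
  rewrite /frob_y (leq_trans (size_polyD _ _)) // geq_max size_polyN.
  rewrite (leq_trans (size_polyC_leq1 _)) //=.
  by rewrite (leq_trans (size_scale_leq _ _)) // size_polyX.
have sye : (size (frob_y X ^+ t.2.2) <= t.2.2.+1)%N.
  rewrite (leq_trans (size_poly_exp_leq _ _)) // ltnS -[leqRHS]mul1n leq_mul2r.
  by rewrite -subn1 leq_subLR sy orbT.
rewrite /frob_monomial -mulrA mul_polyC (leq_trans (size_scale_leq _ _)) //.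
rewrite (leq_trans (size_polyMleq _ _)) // size_polyXn.
have := ltn_ord t.2.1; have := ltn_ord t.2.2; move: sye; lia.
Qed.

Definition cartier_x (t : exponents) : nat := (t.1.1 + s * (p.-1 - t.2.1))%N.
Definition cartier_y (t : exponents) : nat := (t.1.2 + s * (p.-1 - t.2.2))%N.

(** With [k = p - 1 - i0], this is the term of degree [k] in the binomial expansion of [frob_y^j0]:
    it brings [x^(s k)] and [y^(- s j0)]. The binomial coefficient is zero when [j0 < k]. *)
Lemma coef_frob_monomial t :
  (frob_monomial t)`_p.-1 =
  iota ((-1) ^+ t.2.2 *+ 'C(t.2.2, p.-1 - t.2.1)) *
  (x ^+ cartier_x t * y ^+ cartier_y t) / y ^+ (s * p).
Proof.
set k := (p.-1 - t.2.1)%N.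
have kp : (t.2.1 + k = p.-1)%N.
  by rewrite subnKC // -ltnS prednK.
rewrite /frob_monomial -mulrA coefCM mulrC coefXnM ltnNge -{1}kp leq_addr /=.
rewrite -{1}kp addKn.
have -> : (frob_y X ^+ t.2.2)`_k =
    (- y ^- s) ^+ (t.2.2 - k) * (- (x ^+ s / y ^+ s)) ^+ k *+ 'C(t.2.2, k).
  rewrite /frob_y -scaleNr -mul_polyC exprDn coef_sum.
  have term (i : nat) : (((- y ^- s)%:P ^+ (t.2.2 - i) *
      ((- (x ^+ s / y ^+ s))%:P * 'X) ^+ i *+ 'C(t.2.2, i)))`_k =
      (- y ^- s) ^+ (t.2.2 - i) * (- (x ^+ s / y ^+ s)) ^+ i *+ 'C(t.2.2, i) *+ (i == k).
    rewrite coefMn exprMn -!polyC_exp mulrA -polyCM coefCM coefXn eq_sym.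
    by case: eqP => _; rewrite ?mulr1 ?mulr0 ?mul0rn.
  have [tk|kt] := ltnP t.2.2 k.
    rewrite bin_small // mulr0n big1 // => i _; rewrite term.
    case: eqP => [ik|_]; last by rewrite mulr0n.
    by have := ltn_ord i; rewrite ik ltnS leqNgt tk.
  have kt' : (k < t.2.2.+1)%N by rewrite ltnS.
  rewrite (bigD1 (Ordinal kt')) //= term eqxx mulr1n big1 ?addr0 // => i ik.
  by rewrite term; case: eqP => [E|_]; rewrite ?mulr0n //; case/eqP: ik; exact: val_inj.
have [tk|kt] := ltnP t.2.2 k.
  by rewrite bin_small // !mulr0n rmorph0 !mul0r.
rewrite rmorphMn rmorphXn rmorphN rmorph1 /= !(mulrnAl, mulrnAr); congr (_ *+ _).
rewrite [(- y ^- s) ^+ _]exprNn [(- (_ / _)) ^+ k]exprNn expr_div_n exprVn -!exprM.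
have -> : (-1) ^+ t.2.2 = (-1) ^+ (t.2.2 - k) * (-1) ^+ k :> L by rewrite -exprD subnK.
have -> : y ^+ (s * p) = y ^+ s * y ^+ (s * (p.-1 - t.2.2)) * y ^+ (s * (t.2.2 - k)) * y ^+ (s * k).
  have digits q a b d : q = (1 + a + b + d)%N -> (s * q = s + s * a + s * b + s * d)%N.
    by move=> ->; rewrite !mulnDr muln1.
  rewrite -!exprD; congr (_ ^+ _); apply: digits.
  by have := ltn_ord t.2.2; move: kt; lia.
rewrite /cartier_x /cartier_y -/k !exprD.
by field; rewrite !expf_neq0.
Qed.

(** In base [s], the exponent has lowest digit [i1] and quotient [p - 1 - i0], and likewise for
    [y]. *)
Lemma cartier_exponents_inj (t t' : exponents) :
  cartier_x t = cartier_x t' -> cartier_y t = cartier_y t' -> t = t'.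
Proof.
have digits (a a' : 'I_s) (b b' : 'I_p) :
    (a + s * (p.-1 - b) = a' + s * (p.-1 - b'))%N -> a = a' /\ b = b'.
  have s_gt0 : (0 < s)%N by apply: leq_ltn_trans (ltn_ord a).
  rewrite ![(_ + s * _)%N]addnC ![(s * _)%N]mulnC => E.
  have := congr1 (modn^~ s) E; rewrite !modnMDl !modn_small // => aE.
  have := congr1 (divn^~ s) E; rewrite !divnMDl // !divn_small // !addn0 => bE.
  split; apply: val_inj => //=.
  by have := ltn_ord b; have := ltn_ord b'; lia.
case: t t' => [[a b] [a0 b0]] [[a' b'] [a0' b0']].
by move=> /digits /= [-> ->] /digits /= [-> ->].
Qed.

Lemma bin_neq0_pchar (m k : nat) : (k <= m)%N -> (m < p)%N -> 'C(m, k)%:R != 0 :> K.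
Proof.
move=> km mp; have pr_p := pcharf_prime char_p.
rewrite -(dvdn_pcharf char_p); apply/negP => pC.
have : (p %| m`!)%N by rewrite -(bin_fact km) dvdn_mulr.
elim: m mp {km pC} => [|m IH] mp; first by rewrite fact0 dvdn1 => /eqP p1; rewrite p1 in pr_p.
rewrite factS Euclid_dvdM // => /orP[|/IH]; first by rewrite gtnNdvd.
by apply; exact: ltnW.
Qed.

Lemma cartier_monomials (w : form iota) (c : exponents -> K) :
  w = \sum_t iota (c t) *: monomial_form (exp_x t) (exp_y t) ->
  cartier p w 0 <-> forall t : exponents, (p < t.2.1 + t.2.2 + 2)%N -> c t = 0.
Proof.
move=> wE.
(* Coefficients of [Q] enter [phi Q] through their p-th powers, hence the p-th roots of the
   [c t]. *)
have /boolp.choice [d dE] : forall t : exponents, exists d, d ^+ p = c t.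
  by move=> t; exact: const_root.
pose Q := \sum_t (iota (d t))%:P * frob_monomial t.
have wD D' : w D' = D' x * w D.
  rewrite wE !form_sumE mulr_sumr; apply: eq_bigr => t _.
  by rewrite !form_scaleE !monomial_form_der Dx mul1r mulrCA.
have wQ : w D = phi Q.
  rewrite wE form_sumE rmorph_sum; apply: eq_bigr => t _ /=.
  rewrite form_scaleE monomial_form_der Dx mul1r rmorphM /= frob_monomialE evxC /=.
  by rewrite pFrobenius_autE -rmorphXn dE.
have sQ : (size Q <= p + p.-1)%N.
  rewrite (leq_trans (size_sum _ _ _)) //; apply/bigmax_leqP => t _.
  rewrite mul_polyC (leq_trans (size_scale_leq _ _)) //.
  exact: size_frob_monomial.
pose e (t : exponents) : K := (-1) ^+ t.2.2 *+ 'C(t.2.2, p.-1 - t.2.1).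
have e0 (t : exponents) : ~~ (p < t.2.1 + t.2.2 + 2)%N -> e t = 0.
  by move=> tp; rewrite /e bin_small ?mulr0n //; lia.
have Qp : Q`_p.-1 = (\sum_(t : exponents | (p < t.2.1 + t.2.2 + 2)%N)
    iota (d t * e t) * (x ^+ cartier_x t * y ^+ cartier_y t)) / y ^+ (s * p).
  rewrite coef_sum mulr_suml [RHS]big_mkcond; apply: eq_bigr => t _.
  rewrite coefCM coef_frob_monomial -/(e t); case: ifPn => [_|/e0 ->].
    by rewrite rmorphM !mulrA.
  by rewrite rmorph0 !mul0r mulr0.
apply: (iff_trans (cartier_coef Dx wD wQ sQ)); rewrite Qp; split=> [Q0 t tp|c0].
  have free := @monomials_free cartier_x cartier_y
    [pred t : exponents | (p < t.2.1 + t.2.2 + 2)%N] (fun t => d t * e t).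
  have : d t * e t = 0.
    apply: free => //.
    - by move=> r r' _ _; exact: cartier_exponents_inj.
    (* The exponent of [y] is at most [s + s (p - 1) = n - 1]. *)
    - move=> r _; rewrite /cartier_y addn1 ltnS.
      apply: leq_trans (leq_add (ltnW (ltn_ord _)) (leq_mul (leqnn s) (leq_subr _ _))) _.
      by rewrite -mulnS prednK.
    move/eqP: Q0; rewrite mulf_eq0 invr_eq0 expf_eq0 (negPf y0) andbF orbF.
    by move/eqP.
  move/eqP; rewrite mulf_eq0 /e -mulr_natr mulf_eq0 signr_eq0.
  rewrite (negPf (bin_neq0_pchar _ _)) ?orbF //; last by lia.
  by move/eqP => dt; rewrite -dE dt expr0n eqn0Ngt p_gt0.
rewrite big1 ?mul0r // => t tp; have := c0 t tp; rewrite -dE => /eqP.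
by rewrite expf_eq0 => /andP[_ /eqP ->]; rewrite mul0r rmorph0 mul0r.
Qed.

End MonomialForms.

(** * The kernel of the Cartier operator *)

(** The coordinates of one basis in the other form a matrix with independent rows. Applied both
    ways, this makes the dimension unique. *)
Lemma has_dim_leq (K L : fieldType) (iota : {rmorphism K -> L})
    (V : form iota -> Prop) (d d' : nat) :
  has_dim V d -> has_dim V d' -> (d <= d')%N.
Proof.
move=> [b [bV bfree]] [b' [b'V b'free]].
have /boolp.choice [M ME] : forall i : 'I_d, exists c : 'I_d' -> K,
    b i = \sum_(j < d') iota (c j) *: b' j.
  move=> i; apply/b'V/bV; exists (fun j => (j == i)%:R).
  rewrite (bigD1 i) //= eqxx rmorph1 scale1r big1 ?addr0 // => j /negPf ->.
  by rewrite rmorph0 scale0r.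
have : row_free (\matrix_(i, j) M i j).
  apply: inj_row_free => c cM; apply/rowP => i; rewrite mxE.
  apply: (bfree (c 0)).
  transitivity (\sum_(j < d') iota ((c *m \matrix_(i, j) M i j) 0 j) *: b' j).
    under eq_bigr do rewrite ME scaler_sumr.
    rewrite exchange_big; apply: eq_bigr => j _.
    rewrite mxE rmorph_sum scaler_suml; apply: eq_bigr => k _.
    by rewrite mxE scalerA rmorphM.
  by rewrite cM big1 // => j _; rewrite mxE rmorph0 scale0r.
by move=> /eqP <-; exact: rank_leq_col.
Qed.

Section FermatANumber.

Variables (K : closedFieldType) (p s : nat).
Hypothesis char_p : p \in [pchar K].
Variable X : fermat_curve K (s * p + 1).

Local Notation n := (s * p + 1)%N.
Local Notation iota := (const X).

(** Once [i0 + j0 <= p - 2], the bound [(i1 + j1) p + i0 + j0 <= s p - 2] amounts to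
    [i1 + j1 <= s - 1]. High and low digits are thus constrained separately, and the count is a
    product of two triangular numbers. *)
Definition cartier_kernel_exponents : {set exponents p s} :=
  setX [set a : 'I_s * 'I_s | a.1 + a.2 < s]%N [set b : 'I_p * 'I_p | b.1 + b.2 < p.-1]%N.

Local Notation S := cartier_kernel_exponents.

Lemma card_cartier_kernel_exponents :
  (4 * #|S| = s * (s + 1) * p * (p - 1))%N.
Proof.
have p_gt0 := prime_gt0 (pcharf_prime char_p).
rewrite cardsX (_ : 4 = 2 * 2)%N // mulnACA !card_triangle ?leq_pred //.
by rewrite prednK // addn1 subn1 -!mulnA [(p.-1 * p)%N]mulnC.
Qed.

Lemma exponents_inj (t t' : exponents p s) :
  exp_x t = exp_x t' -> exp_y t = exp_y t' -> t = t'.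
Proof.
have digits (a a' : 'I_s) (b b' : 'I_p) : (a * p + b = a' * p + b')%N -> a = a' /\ b = b'.
  have p_gt0 := prime_gt0 (pcharf_prime char_p).
  move=> E; have := congr1 (modn^~ p) E; rewrite !modnMDl !modn_small // => bE.
  have := congr1 (divn^~ p) E; rewrite !divnMDl // !divn_small // !addn0 => aE.
  by split; apply: val_inj.
case: t t' => [[a b] [a0 b0]] [[a' b'] [a0' b0']].
by move=> /digits /= [-> ->] /digits /= [-> ->].
Qed.

Lemma exp_y_lt (t : exponents p s) : (exp_y t < n)%N.
Proof.
rewrite addn1 ltnS /exp_y.
apply: (@leq_trans (t.1.2 * p + p)); first by rewrite leq_add2l ltnW.
by rewrite -mulSnr leq_mul2r ltn_ord orbT.
Qed.

Lemma fermat_a_number : is_a_number X p #|S|.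
Proof.
have p_gt0 := prime_gt0 (pcharf_prime char_p).
have n_neq0 := fermat_degree_neq0 s char_p.
have [D Dx] : exists D : derivation iota, D (coord_x X) = 1.
  apply: (fermat_derivation n_neq0 (fermat_eq X) (@coord_x_transcendental _ _ X)).
  exact: function_field_gen.
pose mon (t : exponents p s) : form iota := monomial_form (exp_x t) (exp_y t).
(* Extension by zero to all exponents: the sum has one term if [t] is in [S] and none otherwise. *)
pose c' (c : 'I_#|S| -> K) (t : exponents p s) : K := \sum_(k | enum_val k == t) c k.
have c'E c : \sum_k iota (c k) *: mon (enum_val k) = \sum_t iota (c' c t) *: mon t.
  rewrite (partition_big (fun k : 'I_#|S| => enum_val k) xpredT) //=.
  apply: eq_bigr => t _; rewrite /c' rmorph_sum scaler_suml.
  by apply: eq_bigr => k /eqP ->.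
have SP t : (t \in S) = (t.1.1 + t.1.2 < s)%N && (t.2.1 + t.2.2 < p.-1)%N.
  by case: t => a b; rewrite in_setX !inE.
have S_deg t : t \in S -> (exp_x t + exp_y t + 3 <= n)%N.
  rewrite SP => /andP[ts tp]; rewrite /exp_x /exp_y.
  have : ((t.1.1 + t.1.2).+1 * p <= s * p)%N by rewrite leq_mul2r ts orbT.
  rewrite mulSn mulnDl; move: tp p_gt0.
  by move: (t.1.1 * p)%N (t.1.2 * p)%N (s * p)%N (t.2.1 : nat) (t.2.2 : nat); lia.
exists (fun k => mon (enum_val k)); split=> [w|c].
  split=> [[hol car]|[c wE]].
    have [c cdeg wE] := holomorphic_monomials char_p Dx hol.
    have c0 := (cartier_monomials char_p Dx wE).1 car.
    exists (fun k => c (enum_val k)); rewrite wE.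
    rewrite -(big_enum_val (fun t => iota (c t) *: mon t)) /=.
    rewrite [RHS]big_mkcond; apply: eq_bigr => t _; case: ifPn => // tS.
    suff -> : c t = 0 by rewrite rmorph0 scale0r.
    apply/eqP; apply: contraR tS => ct; rewrite SP.
    have tp : (t.2.1 + t.2.2 < p.-1)%N.
      by move: ct; apply: contraNT => tp; apply/eqP/c0; lia.
    rewrite tp andbT; have := cdeg t ct; rewrite /exp_x /exp_y.
    rewrite ltnNge => tdeg; apply/negP => st.
    have : (s * p <= (t.1.1 + t.1.2) * p)%N by rewrite leq_mul2r st orbT.
    by rewrite mulnDl; lia.
  split.
    rewrite wE; apply: (@monomial_form_holomorphic _ _ X n_neq0 #|S| (fun k => exp_x (enum_val k))
      (fun k => exp_y (enum_val k)) c) => k.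
    exact/S_deg/enum_valP.
  rewrite c'E in wE; apply/(cartier_monomials char_p Dx wE) => t tp.
  rewrite /c' big1 // => k /eqP kt.
  have := enum_valP k; rewrite kt SP => /andP[_ tp'].
  by exfalso; move: tp tp' p_gt0; move: (t.2.1 : nat) (t.2.2 : nat); lia.
rewrite c'E => c0 k.
have := congr1 (fun w : form iota => w D) c0; rewrite /= form_sumE => cD.
have -> : c k = c' c (enum_val k).
  rewrite /c' (big_pred1 k) // => j; apply/eqP/eqP => [|->] //.
  exact: enum_val_inj.
apply: (@monomials_free K p s char_p X (@exp_x p s) (@exp_y p s) predT) => //.
- by move=> t t' _ _; exact: exponents_inj.
- by move=> t _; exact: exp_y_lt.
apply: (mulIf (invr_neq0 (expf_neq0 (s * p) (fermat_y_neq0 X n_neq0)))).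
rewrite mul0r -[RHS]cD mulr_suml; apply: eq_bigr => t _.
by rewrite form_scaleE /mon monomial_form_der Dx mul1r !mulrA.
Qed.

End FermatANumber.

Theorem theorem3p4 (K : closedFieldType) (p s : nat)
    (char_p : p \in [pchar K]) (s_ge1 : (1 <= s)%N)
    (X : fermat_curve K (s * p + 1)) (a : nat) :
  is_a_number X p a <-> (4 * a = s * (s + 1) * p * (p - 1))%N.
Proof.
have dimX := fermat_a_number char_p X.
rewrite -(card_cartier_kernel_exponents s char_p); split=> [dimXa|/eqP].
  congr (4 * _)%N; apply/eqP; rewrite eqn_leq.
  by rewrite (has_dim_leq dimXa dimX) (has_dim_leq dimX dimXa).
by rewrite eqn_pmul2l // => /eqP ->.
Qed.
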